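(* Let $\beta\in B_n$ be a braid whose first proper Laurent MFW polynomial $h_m$ attains the $z$-degree $\zeta=\deg_zP_{\widehat\beta}$ of $P_{\widehat\beta}$, i.e. $\deg h_m=\zeta$. Then the degree of $h_m$ satisfies $\zeta=x=\min\deg_vP_{\widehat\beta}$, and $h_m$ is monic. Also $y=\deg_vP_{\widehat\beta}\ge\max\{2(M-m)+1-\mu(\widehat\beta),\ \mu(\widehat\beta)-1\}$.
   Context: $B_n$ is the braid group on $n$ strands with standard generators $\sigma_1,\dots,\sigma_{n-1}$; $\widehat\beta$ is the oriented link obtained by the standard closure of $\beta$, and $\mu(\widehat\beta)$ is its number of components; $w=w(\beta)$ is the exponent sum (writhe) of $\beta$. The Homflypt polynomial $P_L(v,z)$ of an oriented link $L$ is determined by $P=1$ on the unknot and $P_{D_+}=vz\,P_{D_0}+v^2P_{D_-}$ for diagrams differing at one crossing (positive, smoothed, negative). For $\beta\in B_n$ one can write uniquely $P_{\widehat\beta}(v,z)=v^{w-n+1}\sum_{j=0}^{n-1}h_j(z)v^{2j}$ with $h_j\in\mathbb Z[z,z^{-1}]$ (a consequence of the Morton-Franks-Williams inequality); the $h_j$ are the Laurent MFW polynomials of $\beta$. $m$ and $M$ are the minimal and maximal $j$ with $h_j\ne0$; $h_m$ is the first proper and $h_M$ the last proper Laurent MFW polynomial. $\deg$ and $\min\deg$ denote the highest and lowest power occurring; a Laurent polynomial is monic if the coefficient of its highest power is $1$. *)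

(* Defs.v *)
From HB Require Import structures.
From mathcomp Require Import all_boot all_order all_algebra.
From mathcomp Require Import boolp.

Set Implicit Arguments.
Unset Strict Implicit.
Unset Printing Implicit Defensive.

Import Order.TTheory GRing.Theory Num.Theory.
Local Open Scope ring_scope.

(* R[X, X^-1] as the subring of Frac(R[X]) of the fractions p / X^k.          *)
Section Laurent.
Variable R : idomainType.

Definition laurent_repr (f : {fraction {poly R}}) (k : nat) (p : {poly R}) :=
  f * tofrac 'X^k = tofrac p.

Definition is_laurent (f : {fraction {poly R}}) : bool :=
  `[< exists k p, laurent_repr f k p >].

Lemma is_laurentP f : reflect (exists k p, laurent_repr f k p) (is_laurent f).
Proof. exact: asboolP. Qed.

Lemma is_laurent_subring : subring_closed is_laurent.
Proof.
split.
- by apply/is_laurentP; exists 0%N, 1; rewrite /laurent_repr expr0 mul1r.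
- move=> f g /is_laurentP[k [p fp]] /is_laurentP[l [q gq]]; apply/is_laurentP.
  exists (k + l)%N, (p * 'X^l - q * 'X^k).
  rewrite /laurent_repr exprD rmorphB !rmorphM /= -fp -gq mulrBl.
  by congr (_ - _); rewrite ?mulrA // mulrAC.
- move=> f g /is_laurentP[k [p fp]] /is_laurentP[l [q gq]]; apply/is_laurentP.
  exists (k + l)%N, (p * q).
  by rewrite /laurent_repr exprD !rmorphM /= -fp -gq mulrACA.
Qed.

HB.instance Definition _ :=
  GRing.isSubringClosed.Build {fraction {poly R}} is_laurent is_laurent_subring.

Record laurent :=
  Laurent { laurent_val : {fraction {poly R}}; _ : is_laurent laurent_val }.

HB.instance Definition _ := [isSub for laurent_val].
HB.instance Definition _ := [Choice of laurent by <:].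
HB.instance Definition _ := [SubChoice_isSubComNzRing of laurent by <:].

Definition laurent_unit : {pred laurent} :=
  fun f => (val f != 0) && is_laurent (val f)^-1.
Definition laurent_inv (f : laurent) : laurent :=
  if laurent_unit f then insubd f (val f)^-1 else f.

Lemma laurent_mulVx : {in laurent_unit, left_inverse 1 laurent_inv *%R}.
Proof.
rewrite /laurent_inv => f; rewrite -topredE /= => uf; have /andP[f0 fV] := uf.
by apply: val_inj; rewrite uf rmorphM rmorph1 /= insubdK // mulVf.
Qed.

Lemma laurent_unitPl (f g : laurent) : g * f = 1 -> laurent_unit f.
Proof.
move=> /(congr1 val); rewrite rmorphM rmorph1 /= => gf1.
have f0 : val f != 0.
  by apply/eqP => f0; move/eqP: gf1; rewrite f0 mulr0 eq_sym oner_eq0.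
rewrite /laurent_unit f0 -[X in is_laurent X]mul1r -gf1 mulfK //.
exact: (valP g).
Qed.

Lemma laurent_invr_out : {in [predC laurent_unit], laurent_inv =1 id}.
Proof. by move=> f /negbTE; rewrite -topredE /= /laurent_inv => ->. Qed.

HB.instance Definition _ := GRing.ComNzRing_hasMulInverse.Build laurent
  laurent_mulVx laurent_unitPl laurent_invr_out.

Lemma laurent_integral : GRing.integral_domain_axiom laurent.
Proof.
move=> f g /(congr1 val); rewrite rmorphM rmorph0 => /eqP.
by rewrite mulf_eq0 -!(rmorph0 (val : laurent -> _)) !(inj_eq val_inj).
Qed.

HB.instance Definition _ :=
  GRing.ComUnitRing_isIntegral.Build laurent laurent_integral.

Lemma is_laurent_poly (p : {poly R}) : is_laurent (tofrac p).
Proof. by apply/is_laurentP; exists 0%N, p; rewrite /laurent_repr expr0 mulr1. Qed.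

Definition laurent_poly (p : {poly R}) : laurent := Laurent (is_laurent_poly p).
Definition laurentC (c : R) : laurent := laurent_poly c%:P.
Definition laurentX : laurent := laurent_poly 'X.

Lemma laurentX_unit : laurentX \is a GRing.unit.
Proof.
apply/andP; split; first by rewrite /= tofrac_eq0 polyX_eq0.
apply/is_laurentP; exists 1%N, 1; rewrite /laurent_repr expr1 mulVf ?tofrac1 //.
by rewrite tofrac_eq0 polyX_eq0.
Qed.

Lemma laurent_has_repr (f : laurent) : exists kp : nat * {poly R},
  laurent_repr (val f) kp.1 kp.2.
Proof. by have /is_laurentP[k [p fp]] := valP f; exists (k, p). Qed.

(* The coefficient of X^i, for i of either sign. *)
Definition lcoef (f : laurent) (i : int) : R :=
  let kp := projT1 (cid (laurent_has_repr f)) in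
  if i + kp.1%:Z is Posz a then kp.2`_a else 0.

(* lcoef does not depend on the representative chosen in its definition. *)
Lemma lcoefE (f : laurent) k p : laurent_repr (val f) k p ->
  forall i, lcoef f i = if i + k%:Z is Posz a then p`_a else 0.
Proof.
rewrite /lcoef; case: cid => -[l q] /= fq fp i.
have pq : p * 'X^l = q * 'X^k.
  apply/eqP; rewrite -tofrac_eq !rmorphM /= -fp -fq.
  by rewrite mulrAC.
have coefE (s : {poly R}) (a b : nat) :
    (if i + a%:Z is Posz c then s`_c else 0) =
    (if i + (a + b)%N%:Z is Posz c then (s * 'X^b)`_c else 0).
  rewrite PoszD addrA; case: (i + a%:Z) => c.
    by rewrite -PoszD coefMXn ltnNge leq_addl /= addnK.
  case E: (Negz c + b%:Z) => [d|//]; rewrite coefMXn ifT //.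
  by rewrite -ltz_nat -E NegzE gtrDr oppr_lt0.
by rewrite (coefE q l k) (coefE p k l) pq addnC.
Qed.

Lemma lcoef_shift (e : int) (q : {poly R}) (i : int) :
  lcoef (laurentX ^ e * laurent_poly q) i =
  if i - e is Posz a then q`_a else 0.
Proof.
case: e => a.
  rewrite (lcoefE (k := 0) (p := 'X^a * q)).
    rewrite addr0; case E: (i - a%:Z) => [b|b]; last first.
      have -> : i = Negz b + a%:Z by rewrite -E subrK.
      case F: (Negz b + a%:Z) => [c|//]; rewrite coefXnM ifT //.
      by rewrite -ltz_nat -F NegzE gtrDr oppr_lt0.
    have -> : i = (b + a)%N%:Z by rewrite PoszD -E subrK.
    by rewrite coefXnM ltnNge leq_addl /= addnK.
  by rewrite /laurent_repr expr0 tofrac1 mulr1 !rmorphM !rmorphXn.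
rewrite (lcoefE (k := a.+1) (p := q)); first by rewrite NegzE opprK.
rewrite /laurent_repr (_ : tofrac 'X^(a.+1) = val (laurentX ^+ a.+1)); last first.
  by rewrite !rmorphXn.
rewrite -(rmorphM (val : laurent -> _)) mulrAC NegzE -exprnN mulVr ?mul1r //.
exact/unitrX/laurentX_unit.
Qed.

End Laurent.

Definition greatest (S : int -> Prop) (d : int) :=
  S d /\ forall e, S e -> e <= d.
Definition least (S : int -> Prop) (d : int) :=
  S d /\ forall e, S e -> d <= e.

Definition Lz := laurent int.
Definition Lvz := laurent Lz.

Definition z : Lvz := laurentC (laurentX int).
Definition v : Lvz := laurentX Lz.

Definition zexp (h : Lz) (i : int) : Prop := lcoef h i <> 0.
Definition vexp_in (P : Lvz) (i : int) : Prop := lcoef P i <> 0.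
Definition zexp_in (P : Lvz) (j : int) : Prop := exists i, zexp (lcoef P i) j.

Definition deg_is (h : Lz) := greatest (zexp h).
Definition degz_is (P : Lvz) := greatest (zexp_in P).
Definition degv_is (P : Lvz) := greatest (vexp_in P).
Definition mindegv_is (P : Lvz) := least (vexp_in P).

Definition lmonic (h : Lz) := exists2 d, deg_is h d & lcoef h d = 1.

(* A diagram in general position with respect to the height function is cut   *)
(* by horizontal lines into slices that contain one cup (local minimum), cap  *)
(* (local maximum) or crossing each. It is read from the bottom to the top;   *)
(* (i, a) is the slice that has i vertical strands to the left of the         *)
(* elementary piece a. A level is described by the orientations of the        *)
(* strands that cross it from left to right, true meaning upwards.            *)
(* In [cup u] the left end has orientation u; the strand of [cross o] that    *)
(* rises to the right passes over the other one iff o.                        *)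
Inductive piece := cup of bool | cap | cross of bool.

Definition diagram := seq (nat * piece).

Definition ins (a : piece) := match a with cup _ => 0 | _ => 2 end%N.
Definition outs (a : piece) := match a with cap => 0 | _ => 2 end%N.

Definition slice (s : seq bool) (x : nat * piece) : option (seq bool) :=
  let: (i, a) := x in
  match a, drop i s with
  | cup u, t => if (i <= size s)%N then Some (take i s ++ [:: u, ~~ u & t])
                else None
  | cap, [:: e, e' & t] => if e != e' then Some (take i s ++ t) else None
  | cross _, [:: e, e' & t] => Some (take i s ++ [:: e', e & t])
  | _, _ => None
  end.

(* The level reached from level s; None if the slices do not fit. *)
Fixpoint level (s : seq bool) (D : diagram) : option (seq bool) :=
  if D is x :: D' then obind (level ^~ D') (slice s x) else Some s.

Definition link_diagram (D : diagram) : Prop := level [::] D = Some [::].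

(* Planar isotopy (first three moves and the two slides of a strand across a  *)
(* maximum or minimum) and Reidemeister moves of sliced diagrams.             *)
Inductive move : diagram -> diagram -> Prop :=
| move_exchange i d a b :
    move [:: (i, a); (i + outs a + d, b)%N] [:: (i + ins a + d, b)%N; (i, a)]
| move_zigzag_l i u : move [:: (i, cup u); (i.+1, cap)] [::]
| move_zigzag_r i u : move [:: (i.+1, cup u); (i, cap)] [::]
| move_slide_cap i o :
    move [:: (i, cross o); (i.+1, cap)] [:: (i.+1, cross (~~ o)); (i, cap)]
| move_slide_cup i u o :
    move [:: (i, cup u); (i.+1, cross o)] [:: (i.+1, cup u); (i, cross (~~ o))]
| move_R1_cap i o : move [:: (i, cross o); (i, cap)] [:: (i, cap)]
| move_R1_cup i u o : move [:: (i, cup u); (i, cross o)] [:: (i, cup (~~ u))]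
| move_R2 i o : move [:: (i, cross o); (i, cross (~~ o))] [::]
| move_R3 i o :
    move [:: (i, cross o); (i.+1, cross o); (i, cross o)]
         [:: (i.+1, cross o); (i, cross o); (i.+1, cross o)].

Definition unknot : diagram := [:: (0%N, cup true); (0%N, cap)].

(* Number of components: sweep from the bottom to the top and keep a label    *)
(* for each strand of the level, such that two strands have the same label    *)
(* iff they are joined below the level; k is a label not used so far. A cap   *)
(* that joins equal labels closes a component, otherwise it merges two arcs.  *)
Fixpoint components_rec (k : nat) (s : seq nat) (D : diagram) : nat :=
  match D with
  | [::] => 0
  | (i, cup _) :: D' =>
      components_rec k.+1 (take i s ++ [:: k, k & drop i s]) D'
  | (i, cross _) :: D' =>
      components_rec k
        (take i s ++ [:: nth 0 s i.+1, nth 0 s i & drop i.+2 s]) D'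
  | (i, cap) :: D' =>
      let: a := nth 0 s i in
      let: b := nth 0 s i.+1 in
      (a == b) + components_rec k
        [seq if c == b then a else c | c <- take i s ++ drop i.+2 s] D'
  end%N.

Definition components (D : diagram) : nat := components_rec 0 [::] D.

(* A crossing of strands i and i.+1 of a level s: it is positive iff either   *)
(* the two strands run in the same vertical direction and the one rising to   *)
(* the right is over, or they run in opposite directions and it is under.     *)
Definition parallel (s : seq bool) (i : nat) : bool :=
  nth true s i == nth true s i.+1.
Definition positive (s : seq bool) (i : nat) : diagram :=
  [:: (i, cross (parallel s i))].
Definition negative (s : seq bool) (i : nat) : diagram :=
  [:: (i, cross (~~ parallel s i))].
Definition smoothed (s : seq bool) (i : nat) : diagram :=
  if parallel s i then [::] else [:: (i, cap); (i, cup (nth true s i.+1))].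

Record homflypt (P : diagram -> Lvz) : Prop := {
  homflypt_isotopy : forall D E A B : diagram, move A B ->
    link_diagram (D ++ A ++ E) -> link_diagram (D ++ B ++ E) ->
    P (D ++ A ++ E) = P (D ++ B ++ E);
  homflypt_unknot : P unknot = 1;
  homflypt_skein : forall (D E : diagram) (s : seq bool) (i : nat),
    level [::] D = Some s -> link_diagram (D ++ positive s i ++ E) ->
    P (D ++ positive s i ++ E) =
      v * z * P (D ++ smoothed s i ++ E) + v ^+ 2 * P (D ++ negative s i ++ E)
}.

(* Words in the standard generators of B_n: (i, true) is sigma_(i+1) and      *)
(* (i, false) is its inverse. Every braid is represented by such words, and   *)
(* the word enters below only through its exponent sum and its closure.       *)
Definition braid_word (n : nat) := seq ('I_n.-1 * bool).

Section Braid.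
Variables (n : nat) (beta : braid_word n).

Definition writhe : int := \sum_(x <- beta) (if x.2 then 1 else -1).

(* n nested cups, the braid running upwards on the left, n nested caps *)
Definition braid_closure : diagram :=
  [seq (i, cup true) | i <- iota 0 n] ++
  [seq (val x.1, cross x.2) | x <- beta] ++
  [seq (i, cap) | i <- rev (iota 0 n)].

(* h_j in P = v^(w-n+1) sum_(j < n) h_j v^(2j), for the value P of the        *)
(* Homflypt polynomial of the closure; see mfw_unique.                        *)
Definition mfw (P : Lvz) (j : 'I_n) : Lz :=
  lcoef P (writhe - n%:Z + 1 + 2 * j%:Z).

Lemma mfw_unique (P : Lvz) (h : 'I_n -> Lz) :
  P = v ^ (writhe - n%:Z + 1) * \sum_j laurentC (h j) * v ^+ (2 * j) ->
  mfw P =1 h.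
Proof.
move=> -> j; rewrite /mfw.
have -> : \sum_j laurentC (h j) * v ^+ (2 * j) =
    laurent_poly (\sum_j (h j)%:P * 'X^(2 * j)).
  apply: val_inj; rewrite rmorph_sum /= rmorph_sum; apply: eq_bigr => k _.
  rewrite [RHS]rmorphM; congr (_ * _).
  by rewrite -[LHS]/(val _) !rmorphXn.
rewrite lcoef_shift addrC addKr -PoszM coef_sum (bigD1 j) //= big1 => [|k].
  by rewrite mul_polyC coefZ coefXn eqxx mulr1 addr0.
rewrite -val_eqE /= => kj; rewrite mul_polyC coefZ coefXn eqn_mul2l /=.
by rewrite eq_sym (negbTE kj) mulr0.
Qed.

End Braid.

Definition first_proper n (h : 'I_n -> Lz) (m : 'I_n) :=
  h m <> 0 /\ forall j, h j <> 0 -> (m <= j)%N.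
Definition last_proper n (h : 'I_n -> Lz) (M : 'I_n) :=
  h M <> 0 /\ forall j, h j <> 0 -> (j <= M)%N.

(* Main.v *)
From HB Require Import structures.
From mathcomp Require Import all_boot all_order all_algebra all_fingroup.
From mathcomp Require Import ring zify.
Require Import Defs.

Set Implicit Arguments.
Unset Strict Implicit.
Unset Printing Implicit Defensive.

Import Order.TTheory GRing.Theory Num.Theory.
Local Open Scope ring_scope.

(** Let [w] be a braid word on [n] strands whose closure has [mu] components,
    and let [e] be its exponent sum minus [n] plus 1.  All the assertions follow
    from one normal form: there is a polynomial [F] in [z] and [t] with
    [z ^ (mu - 1) * P = v ^ e * F(z, v ^ 2)], of degree less than [n] in [t],
    with two known specializations,
    [v ^ e * F(v^-1 - v, v ^ 2) = (v^-1 - v) ^ (mu - 1)] and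
    [F(0, t) = (1 - t) ^ (mu - 1) * R(t)] with [R(1) = 1].
    The bound on the degree is the Morton-Franks-Williams inequality; the first
    specialization holds since the constant 1 satisfies the skein relation at
    [z = v^-1 - v]; the second one describes the coefficient of
    [z ^ (1 - mu)] in [P].

    The normal form ([braid_has_normalized]) is proved along the usual
    computation of a Markov trace.  In terms of [F], the skein relation at a
    crossing reads [F+ = F- + q * F0], where [q] is 1 or [z ^ 2] according to
    whether smoothing the crossing adds or removes a component.  A positive
    stabilization keeps [F], a negative one multiplies it by [t], and a new
    unlinked strand multiplies it by [1 - t].  All three preserve the two
    specializations.  Every word is reached from the trivial word on one strand
    in this way: modulo skein relations, braid relations bring it to a form in
    which the last generator occurs at most once ([top_generator_ind]).
    Conjugation and stabilization of closures are obtained by sliding crossings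
    over maxima and minima.

    Write [h_j = z ^ (1 - mu) * F_j], where [F_j] is the coefficient of [t ^ j],
    and substitute [z = v^-1 - v].  The lowest power of [v] in
    [v ^ (e + 2 * j) * h_j] is then at least [e + 2 * j - zeta].  So if [h_m]
    attains the degree [zeta], the lowest term of the sum comes from [h_m]
    alone, and it is [c * v ^ (x - zeta)] for the leading coefficient [c] of [h_m].
    Since the sum is 1, [x = zeta] and [c = 1] ([lowest_term]).  Moreover
    [zeta >= 1 - mu] because [F_m] is a polynomial.  Finally [F(0, t)] is a
    nonzero multiple of [(1 - t) ^ (mu - 1)] whose exponents lie between [m] and
    [M], hence [mu - 1 <= M - m] ([components_le_span]).  As [y] is at least
    [x + 2 * (M - m)], both lower bounds for [y] follow. *)

(** * Sliced diagrams *)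

Local Arguments slice : simpl never.

Section Levels.
Local Open Scope nat_scope.

Lemma level_cat s A B : level s (A ++ B) = obind (level ^~ B) (level s A).
Proof. by elim: A s => //= x A IH s; case: slice. Qed.

Lemma level_cons s x D : level s (x :: D) = obind (level ^~ D) (slice s x).
Proof. by []. Qed.

Lemma level1 s x : level s [:: x] = slice s x.
Proof. by rewrite /=; case: slice. Qed.

Lemma slice_shift l s i a :
  slice (l ++ s) (size l + i, a) = omap (cat l) (slice s (i, a)).
Proof.
have dropE : drop (size l + i) (l ++ s) = drop i s.
  by rewrite addnC -drop_drop drop_size_cat.
have takeE : take (size l + i) (l ++ s) = l ++ take i s.
  by rewrite take_cat ltnNge leq_addr addKn.
rewrite /slice dropE takeE size_cat leq_add2l.
case: a => [u||o]; first by case: ifP => //= _; rewrite catA.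
  by case: drop => [|e [|e' t]] //=; case: ifP => //=; rewrite catA.
by case: drop => [|e [|e' t]] //=; rewrite catA.
Qed.

Lemma slice_out s i a : size s < i -> slice s (i, a) = None.
Proof.
move=> si; rewrite /slice drop_oversize; last exact: ltnW.
by case: a => //= u; rewrite leqNgt si.
Qed.

Lemma slice_at l s i a : size l = i ->
  slice (l ++ s) (i, a) = omap (cat l) (slice s (0, a)).
Proof. by move=> <-; rewrite -slice_shift addn0. Qed.

Lemma slice_cup0 s u : slice s (0, cup u) = Some [:: u, ~~ u & s].
Proof. by rewrite /slice drop0 take0. Qed.

Lemma slice_cap0 e e' s :
  slice [:: e, e' & s] (0, cap) = if e != e' then Some s else None.
Proof. by rewrite /slice drop0 take0. Qed.

Lemma slice_cross0 e e' s o :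
  slice [:: e, e' & s] (0, cross o) = Some [:: e', e & s].
Proof. by rewrite /slice drop0 take0. Qed.

Lemma slice2 e e' s j b :
  slice [:: e, e' & s] (j.+2, b) = omap (cat [:: e; e']) (slice s (j, b)).
Proof. by rewrite -slice_shift. Qed.

Lemma exchange_level s i d a b :
  level s [:: (i, a); (i + outs a + d, b)] =
  level s [:: (i + ins a + d, b); (i, a)].
Proof.
have [si|is_] := ltnP (size s) i.
  rewrite /= slice_out //= slice_out //.
  by rewrite (leq_trans si) // -addnA leq_addr.
rewrite -(cat_take_drop i s); have : size (take i s) = i by rewrite size_takel.
move: (take i s) (drop i s) => l r {is_ s} <-; rewrite /level.
have shift0 s c := @slice_at l s _ c erefl.
rewrite shift0 -!addnA slice_shift.
case: a => [u||o].
- rewrite slice_cup0 /= slice_shift slice2 !add0n.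
  by case: (slice r (d, b)) => //= t; rewrite shift0 slice_cup0.
- case: r => [|e [|e' r]]; do ?by rewrite /slice /=; case: b.
  rewrite slice2 slice_cap0 !add0n; case: (boolP (e != e')) => ee' /=.
    rewrite slice_shift.
    by case: (slice r (d, b)) => //= t; rewrite shift0 slice_cap0 ee'.
  case: (slice r (d, b)) => //= t.
  by rewrite shift0 slice_cap0 (negbTE ee').
- case: r => [|e [|e' r]]; do ?by rewrite /slice /=; case: b.
  rewrite slice2 slice_cross0 /= slice_shift slice2.
  by case: (slice r (d, b)) => //= t; rewrite shift0 slice_cross0.
Qed.

(** A move read from left to right can be made at every level where its left
    side fits.  Away from the exchange of distant slices, only the at most three
    strands next to the move matter, so that the levels can be compared by
    computation after the strands on the left are split off. *)
Lemma move_level A B s t :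
  move A B -> level s A = Some t -> level s B = Some t.
Proof.
have reduce i (A0 B0 : diagram) : A0 <> [::] ->
    (forall r q, level r A0 = Some q -> level r B0 = Some q) ->
    level s [seq (x.1 + i, x.2) | x <- A0] = Some t ->
    level s [seq (x.1 + i, x.2) | x <- B0] = Some t.
  move=> A0n AB; have [si|is_] := ltnP (size s) i.
    case: A0 A0n {AB} => [//|[j a] A0] _ /=.
    by rewrite slice_out // (leq_trans si) ?leq_addl.
  rewrite -(cat_take_drop i s).
  have {is_}: size (take i s) = i by rewrite size_takel.
  move: (take i s) (drop i s) => l r <-.
  have shiftE (C : diagram) q :
      level (l ++ q) [seq (x.1 + size l, x.2) | x <- C]
      = omap (cat l) (level q C).
    elim: C q => //= -[j c] C IH q.
    by rewrite addnC slice_shift; case: slice => /=.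
  by rewrite !shiftE; case E: (level r A0) => [q|] //= <-; rewrite (AB _ _ E).
case=> {A B} [i d a b|i u|i u|i o|i u o|i o|i u o|i o|i o].
- by rewrite exchange_level.
- apply: (reduce i [:: (0, cup u); (1, cap)] [::]) => // r q.
  by rewrite /= /slice /= drop0 take0; case: r => [|e r] //=; case: u; case: e.
- apply: (reduce i [:: (1, cup u); (0, cap)] [::]) => // r q.
  rewrite /= /slice /=; case: r => [|e r] //=.
  by rewrite take0 drop0; case: u; case: e.
- apply: (reduce i [:: (0, cross o); (1, cap)]
    [:: (1, cross (~~ o)); (0, cap)]) => // r q; rewrite /= /slice /=.
  by case: r => [|e [|e' [|e'' r]]] //=; rewrite !drop0; case: ifP.
- apply: (reduce i [:: (0, cup u); (1, cross o)]
    [:: (1, cup u); (0, cross (~~ o))]) => // r q; rewrite /= /slice /=.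
  by case: r => [|e r] //=; rewrite ?take0 ?drop0.
- apply: (reduce i [:: (0, cross o); (0, cap)] [:: (0, cap)]) => // r q.
  rewrite /= /slice /=; case: r => [|e [|e' r]] //=; rewrite ?drop0 ?take0.
  by rewrite eq_sym; case: ifP.
- apply: (reduce i [:: (0, cup u); (0, cross o)] [:: (0, cup (~~ u))]) => // r q.
  by rewrite /= take0 drop0 slice_cross0 negbK.
- apply: (reduce i [:: (0, cross o); (0, cross (~~ o))] [::]) => // r q.
  by case: r => [|e [|e' r]] //=; rewrite drop0 slice_cross0.
- apply: (reduce i [:: (0, cross o); (1, cross o); (0, cross o)]
    [:: (1, cross o); (0, cross o); (1, cross o)]) => // r q.
  rewrite /= /slice /=.
  by case: r => [|e [|e' [|e'' r]]] //=; rewrite ?drop0.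
Qed.

Definition braid_level k : seq bool := nseq k true ++ nseq k false.

Lemma slice_cup_braid_level k :
  slice (braid_level k) (k, cup true) = Some (braid_level k.+1).
Proof.
rewrite /braid_level slice_at ?size_nseq // slice_cup0.
by rewrite -{1}[k.+1]addn1 nseqD -catA.
Qed.

Lemma slice_cap_braid_level k :
  slice (braid_level k.+1) (k, cap) = Some (braid_level k).
Proof.
rewrite /braid_level -{1}[k.+1]addn1 nseqD -catA.
by rewrite slice_at ?size_nseq // slice_cap0.
Qed.

Lemma slice_cross_nseq l b k i o t : i.+1 < k ->
  slice (l ++ nseq k b ++ t) (size l + i, cross o) = Some (l ++ nseq k b ++ t).
Proof.
move=> ik; have -> : k = i + (k - i.+2).+2 by lia.
rewrite slice_shift nseqD -catA slice_at ?size_nseq //.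
Qed.

Lemma slice_cross_left k i o : i.+1 < k ->
  slice (braid_level k) (i, cross o) = Some (braid_level k).
Proof. exact: (@slice_cross_nseq [::]). Qed.

End Levels.

(** * Braid words and their closures *)

Definition word := seq (nat * bool).
Definition on_strands n (w : word) := all (fun x => x.1.+1 < n)%N w.
Definition crossings (w : word) : diagram := [seq (x.1, cross x.2) | x <- w].
Definition cups n : diagram := [seq (i, cup true) | i <- iota 0 n].
Definition caps n : diagram := [seq (i, cap) | i <- rev (iota 0 n)].
Definition closure n (w : word) : diagram := cups n ++ crossings w ++ caps n.

Lemma cupsS n : cups n.+1 = cups n ++ [:: (n, cup true)].
Proof. by rewrite /cups -[n.+1]addn1 iotaD map_cat. Qed.

Lemma capsS n : caps n.+1 = (n, cap) :: caps n.
Proof. by rewrite /caps -[n.+1]addn1 iotaD rev_cat. Qed.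

Lemma crossings_cat w1 w2 : crossings (w1 ++ w2) = crossings w1 ++ crossings w2.
Proof. exact: map_cat. Qed.

Lemma level_cups n : level [::] (cups n) = Some (braid_level n).
Proof.
elim: n => // n IH.
by rewrite cupsS level_cat IH -slice_cup_braid_level -level1.
Qed.

Lemma level_caps n : level (braid_level n) (caps n) = Some [::].
Proof. by elim: n => // n IH; rewrite capsS level_cons slice_cap_braid_level. Qed.

Lemma level_crossings n w : on_strands n w ->
  level (braid_level n) (crossings w) = Some (braid_level n).
Proof.
by elim: w => // -[i o] w IH /andP[iw /IH]; rewrite level_cons slice_cross_left.
Qed.

Section Isotopy.
Variables (P : diagram -> Lvz) (HP : homflypt P).

(** [A] can be replaced by [B] in any link diagram.  The relation is directed
    because some of the moves, read backwards, need not fit the level. *)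
Definition rewrites (A B : diagram) := forall D E, link_diagram (D ++ A ++ E) ->
  link_diagram (D ++ B ++ E) /\ P (D ++ A ++ E) = P (D ++ B ++ E).

Lemma rewrites_refl A : rewrites A A.
Proof. by []. Qed.

Lemma rewrites_trans B A C : rewrites A B -> rewrites B C -> rewrites A C.
Proof. by move=> AB BC D E /AB[/BC[? <-] <-]. Qed.

Lemma rewrites_cat A B C D :
  rewrites A B -> rewrites C D -> rewrites (A ++ C) (B ++ D).
Proof.
move=> AB CD E F; rewrite -!catA => /AB[+ ->].
by rewrite !(catA E) => /CD.
Qed.

Lemma rewrites_catl A B C : rewrites A B -> rewrites (C ++ A) (C ++ B).
Proof. exact/rewrites_cat/rewrites_refl. Qed.

Lemma rewrites_catr A B C : rewrites A B -> rewrites (A ++ C) (B ++ C).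
Proof. by move=> AB; apply/rewrites_cat/rewrites_refl. Qed.

Lemma rewrites_move A B : move A B -> rewrites A B.
Proof.
move=> mAB D E linkA; suff linkB : link_diagram (D ++ B ++ E).
  by split=> //; apply: (homflypt_isotopy HP).
move: linkA; rewrite /link_diagram !level_cat; case: level => //= s.
rewrite !level_cat; case Es: (level s A) => [t|] //=.
by rewrite (move_level mAB Es).
Qed.

(** The distance between the two slices is written as a difference, so that
    instances are settled by linear arithmetic on explicit positions. *)
Lemma rewrites_exchange i j k a b :
  j = (i + outs a + (k - (i + ins a)))%N -> (i + ins a <= k)%N ->
  rewrites [:: (i, a); (j, b)] [:: (k, b); (i, a)].
Proof.
move=> -> /subnKC kE; rewrite -[in X in rewrites _ X]kE.
by apply: rewrites_move; apply: move_exchange.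
Qed.

Lemma rewrites_exchange_rev i j k a b :
  j = (i + outs a + (k - (i + ins a)))%N -> (i + ins a <= k)%N ->
  rewrites [:: (k, b); (i, a)] [:: (i, a); (j, b)].
Proof.
move=> jE ik D E; have jE' := subnKC ik; rewrite -{}jE' in jE *.
rewrite addKn in jE; rewrite {}jE => linkA.
suff linkB : link_diagram
    (D ++ [:: (i, a); (i + outs a + (k - (i + ins a)), b)%N] ++ E).
  by split=> //; rewrite (homflypt_isotopy HP (move_exchange i _ a b)).
move: linkA; rewrite /link_diagram !level_cat; case: level => // s linkA.
rewrite -[LHS]/(level s ([:: _; _] ++ E)) level_cat exchange_level.
by rewrite -level_cat.
Qed.

Lemma link_closure n w : on_strands n w -> link_diagram (closure n w).
Proof.
move=> nw; rewrite /link_diagram /closure level_cat level_cups.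
by rewrite [LHS]/= level_cat level_crossings //; apply: level_caps.
Qed.

Lemma closure_rewrites n a b A B :
    on_strands n (a ++ A ++ b) -> rewrites (crossings A) (crossings B) ->
  P (closure n (a ++ A ++ b)) = P (closure n (a ++ B ++ b)).
Proof.
move=> /link_closure; rewrite /closure !crossings_cat -!catA !(catA (cups n)).
by move=> + AB => /AB[].
Qed.

Lemma on_strands_cat n a b :
  on_strands n (a ++ b) = on_strands n a && on_strands n b.
Proof. exact: all_cat. Qed.

Lemma closure_R2 n a b i o : on_strands n (a ++ [:: (i, o), (i, ~~ o) & b]) ->
  P (closure n (a ++ [:: (i, o), (i, ~~ o) & b])) = P (closure n (a ++ b)).
Proof.
move=> nw; apply: (@closure_rewrites _ _ _ [:: (i, o); (i, ~~ o)] [::]) => //.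
exact/rewrites_move/move_R2.
Qed.

Lemma closure_R3 n a b i o :
    on_strands n (a ++ [:: (i, o), (i.+1, o), (i, o) & b]) ->
  P (closure n (a ++ [:: (i, o), (i.+1, o), (i, o) & b])) =
  P (closure n (a ++ [:: (i.+1, o), (i, o), (i.+1, o) & b])).
Proof.
move=> nw; apply: (@closure_rewrites _ _ _ [:: (i, o); (i.+1, o); (i, o)]
  [:: (i.+1, o); (i, o); (i.+1, o)]) => //.
exact/rewrites_move/move_R3.
Qed.

Lemma closure_far n a b i j o o' : (i.+1 < j)%N ->
    on_strands n (a ++ [:: (i, o), (j, o') & b]) ->
  P (closure n (a ++ [:: (i, o), (j, o') & b])) =
  P (closure n (a ++ [:: (j, o'), (i, o) & b])).
Proof.
move=> ij nw; apply: (@closure_rewrites _ _ _ [:: (i, o); (j, o')]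
  [:: (j, o'); (i, o)]) => //.
by apply: rewrites_exchange => /=; lia.
Qed.

Lemma closure_skein n a b i : on_strands n (a ++ (i, true) :: b) ->
  P (closure n (a ++ (i, true) :: b)) =
    v * z * P (closure n (a ++ b)) +
    v ^+ 2 * P (closure n (a ++ (i, false) :: b)).
Proof.
move=> nw; have := link_closure nw; move: nw.
rewrite /closure !crossings_cat -!catA !(catA (cups n)).
rewrite on_strands_cat /= => /and3P[na ni nb].
have aL : level [::] (cups n ++ crossings a) = Some (braid_level n).
  by rewrite level_cat level_cups; apply: level_crossings.
have par : parallel (braid_level n) i.
  by rewrite /parallel !nth_cat size_nseq ni ltnW // !nth_nseq ni ltnW.
have := homflypt_skein HP (i := i) (E := crossings b ++ caps n) aL.
by rewrite /positive /negative /smoothed par.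
Qed.

(** ** Conjugation *)

(** A crossing of the strands [i] and [i + 1] right below the nested maxima can
    be moved to the other ends of the same two arcs.  Only the two maxima of
    these arcs matter; the inner ones are exchanged with the crossing. *)
Lemma slide_caps n i o : (i.+1 < n)%N ->
  rewrites ((i, cross o) :: caps n) ((n + (n - i.+2), cross o)%N :: caps n).
Proof.
elim: n => // n IH; rewrite ltnS capsS leq_eqVlt.
case/orP=> [/eqP <-|/[dup] ni {}/IH IH].
  have -> : (i.+2 + (i.+2 - i.+2))%N = i.+2 by lia.
  rewrite capsS.
  (* The crossing passes over the maximum of its right strand, then the two
     maxima change their order, and it passes over that of its left strand. *)
  apply: (@rewrites_trans
      [:: (i.+1, cross (~~ o)), (i, cap), (i, cap) & caps i]).
    apply: (@rewrites_catr [:: _; _] [:: _; _] (_ :: _)).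
    exact/rewrites_move/move_slide_cap.
  apply: (@rewrites_trans
      [:: (i.+1, cross (~~ o)), (i.+2, cap), (i, cap) & caps i]).
    apply: (@rewrites_cat [:: _] [:: _] [:: _, _ & _] [:: _, _ & _]) => //.
    apply: (@rewrites_catr [:: _; _] [:: _; _]).
    by apply: rewrites_exchange => /=; lia.
  apply: (@rewrites_catr [:: _; _] [:: _; _] (_ :: _)).
  rewrite -[o in X in rewrites _ X]negbK.
  exact/rewrites_move/move_slide_cap.
apply: (@rewrites_trans [:: (n, cap), (i, cross o) & caps n]).
  apply: (@rewrites_catr [:: _; _] [:: _; _]).
  by apply: rewrites_exchange => /=; lia.
apply: (@rewrites_trans [:: (n, cap), (n + (n - i.+2), cross o)%N & caps n]).
  exact: (@rewrites_catl _ _ [:: _]).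
apply: (@rewrites_catr [:: _; _] [:: _; _]).
by apply: rewrites_exchange => /=; lia.
Qed.

Lemma slide_cups n i o : (i.+1 < n)%N ->
  rewrites (cups n ++ [:: (n + (n - i.+2), cross o)%N])
    (cups n ++ [:: (i, cross o)]).
Proof.
elim: n => // n IH; rewrite ltnS cupsS leq_eqVlt.
case/orP=> [/eqP <-|/[dup] ni {}/IH IH].
  have -> : (i.+2 + (i.+2 - i.+2))%N = i.+2 by lia.
  rewrite cupsS -!catA; apply: rewrites_catl => /=.
  apply: (@rewrites_trans
      [:: (i, cup true); (i.+2, cup true); (i.+1, cross (~~ o))]).
    apply: (@rewrites_catl [:: _; _] [:: _; _] [:: _]).
    exact/rewrites_move/move_slide_cup.
  apply: (@rewrites_trans
      [:: (i, cup true); (i, cup true); (i.+1, cross (~~ o))]).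
    apply: (@rewrites_catr [:: _; _] [:: _; _] [:: _]).
    by apply: rewrites_exchange => /=; lia.
  apply: (@rewrites_catl [:: _; _] [:: _; _] [:: _]).
  rewrite -[o in X in rewrites _ X]negbK.
  exact/rewrites_move/move_slide_cup.
rewrite -!catA /=.
apply: (@rewrites_trans
    (cups n ++ [:: (n + (n - i.+2), cross o)%N; (n, cup true)])).
  by apply: rewrites_catl; apply: rewrites_exchange => /=; lia.
apply: (@rewrites_trans (cups n ++ [:: (i, cross o); (n, cup true)])).
  rewrite -[[:: _; (n, _)] in X in rewrites X]cat1s.
  rewrite -[[:: _; (n, _)]]cat1s.
  by rewrite !catA; apply: rewrites_catr.
by apply: rewrites_catl; apply: rewrites_exchange => /=; lia.
Qed.

Lemma far_right_crossings n w k o : on_strands n w -> (n <= k)%N ->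
  rewrites (crossings w ++ [:: (k, cross o)]) ((k, cross o) :: crossings w).
Proof.
move=> + nk; elim: w => [|[i o'] w IH] //= /andP[iw /IH {}IH].
apply: (@rewrites_trans [:: (i, cross o'), (k, cross o) & crossings w]).
  exact: (@rewrites_catl _ _ [:: _]).
apply: (@rewrites_catr [:: _; _] [:: _; _]).
by apply: rewrites_exchange => /=; lia.
Qed.

(** The last crossing goes over the maxima to the returning strands, down along
    them past the braid, and through the minima to the start of the braid. *)
Lemma closure_rcons n w x : on_strands n (x :: w) ->
  P (closure n (rcons w x)) = P (closure n (x :: w)).
Proof.
case: x => i o /= /andP[ni nw].
have /(_ [::] [::]) :
    rewrites (closure n (rcons w (i, o))) (closure n ((i, o) :: w)).
  rewrite /closure -cats1 crossings_cat -catA /=.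
  apply: (@rewrites_trans (cups n ++ crossings w ++
      [:: (n + (n - i.+2), cross o)%N & caps n])).
    by do 2!apply: rewrites_catl; apply: slide_caps.
  apply: (@rewrites_trans (cups n ++
      [:: (n + (n - i.+2), cross o)%N & crossings w ++ caps n])).
    apply: rewrites_catl; rewrite -cat1s catA -cat_cons.
    by apply: rewrites_catr; apply: (@far_right_crossings n); rewrite ?leq_addr.
  rewrite -cat1s -[_ :: crossings w ++ _]cat1s !catA.
  by do 2!apply: rewrites_catr; apply: slide_cups.
rewrite !cats0 => -[] //; apply: link_closure.
by rewrite -cats1 on_strands_cat /= nw ni.
Qed.

Lemma closure_rot n a b : on_strands n (a ++ b) ->
  P (closure n (a ++ b)) = P (closure n (b ++ a)).
Proof.
elim: a b => [|x a IH] b; first by rewrite cats0.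
move=> nw; rewrite -(@closure_rcons n (a ++ b)) // -cats1 -catA IH.
  by rewrite -catA.
by move: nw; rewrite /= !on_strands_cat /= => /and3P[-> -> ->].
Qed.

(** ** Stabilization *)

(** The innermost minimum is lifted past the braid; the additional crossing then
    becomes a kink in the arc between it and the innermost maximum. *)
Lemma closure_stab n w o : (0 < n)%N -> on_strands n w ->
  P (closure n.+1 (rcons w (n.-1, o))) = P (closure n w).
Proof.
case: n => // n _ nw.
have /(_ [::] [::]) :
    rewrites (closure n.+2 (rcons w (n, o))) (closure n.+1 w).
  rewrite /closure cupsS capsS -cats1 crossings_cat -!catA.
  apply: rewrites_catl.
  apply: (@rewrites_trans (crossings w ++
      [:: (n.+1, cup true), (n, cross o), (n.+1, cap) & caps n.+1])).
    have /rewrites_catr : rewrites ((n.+1, cup true) :: crossings w)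
        (crossings w ++ [:: (n.+1, cup true)]).
      elim: w nw => //= -[i o'] w IH /andP[iw /IH {}IH].
      apply: (@rewrites_trans
          [:: (i, cross o'), (n.+1, cup true) & crossings w]).
        apply: (@rewrites_catr [:: _; _] [:: _; _]).
        by rewrite /= in iw; apply: rewrites_exchange_rev => /=; lia.
      exact: (@rewrites_catl _ _ [:: _]).
    by move=> /(_ [:: (n, cross o), (n.+1, cap) & caps n.+1]); rewrite -catA.
  apply: rewrites_catl; apply: (@rewrites_catr [:: _; _; _] [::]).
  apply: (@rewrites_trans
      [:: (n.+1, cup true); (n.+1, cross (~~ o)); (n, cap)]).
    by apply: (@rewrites_catl _ _ [:: _]); apply/rewrites_move/move_slide_cap.
  apply: (@rewrites_trans [:: (n.+1, cup false); (n, cap)]).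
    apply: (@rewrites_catr [:: _; _] [:: _]).
    exact/rewrites_move/(@move_R1_cup _ true).
  exact/rewrites_move/move_zigzag_r.
rewrite !cats0 => -[] //; apply: link_closure.
rewrite -cats1 on_strands_cat /= ltnS leqnn !andbT.
by apply: sub_all nw => -[i ?] /=; lia.
Qed.
End Isotopy.

(** * Words with at most one top generator *)

Section PositiveWords.
Local Open Scope nat_scope.

Lemma word_commute (U : seq nat -> Prop) a k u b :
    (forall a i j b, i.+1 < j ->
       U (a ++ [:: i, j & b]) <-> U (a ++ [:: j, i & b])) ->
    all (fun i => i.+1 < k) u ->
  U (a ++ u ++ k :: b) <-> U (a ++ k :: u ++ b).
Proof.
move=> far; elim: u a => [|i u IH] a //= /andP[ik uk].
rewrite -cat_rcons IH // cat_rcons; exact: far.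
Qed.

Lemma split_first (k : nat) u : k \in u ->
  exists u1 u2, u = u1 ++ k :: u2 /\ k \notin u1.
Proof.
elim: u => // x u IH; rewrite inE; have [<- _|kx /= /IH] := eqVneq.
  by exists [::], u.
by case=> u1 [u2 [-> ku1]]; exists (x :: u1), u2; rewrite inE negb_or kx.
Qed.

Lemma all_ltnS_notin k u :
  all (fun i => i < k.+1) u -> k \notin u -> all (fun i => i < k) u.
Proof.
move=> /allP uk ku; apply/allP => i iu; have := uk i iu.
by rewrite ltnS leq_eqVlt => /orP[/eqP ik|//]; rewrite -ik iu in ku.
Qed.

(** Positive words are considered up to far commutation and braid relations,
    and words with a repeated letter count as known.  Two consecutive top
    letters [k] enclose a word [b] in lower letters which, by induction on [k], contains
    [k - 1] at most once.  If it does not contain [k - 1], the two letters [k]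
    meet.  If it does, they come next to [k - 1] and a braid relation reduces
    their number. *)
Lemma top_generator_ind (U : seq nat -> Prop) k :
    (forall a i b, U (a ++ [:: i, i & b])) ->
    (forall a i j b, i.+1 < j ->
       U (a ++ [:: i, j & b]) <-> U (a ++ [:: j, i & b])) ->
    (forall a i b, U (a ++ [:: i, i.+1, i & b]) ->
       U (a ++ [:: i.+1, i, i.+1 & b])) ->
    (forall u, all (fun i => i < k) u -> count_mem k.-1 u <= 1 -> U u) ->
  forall u, all (fun i => i < k) u -> U u.
Proof.
elim: k U => [|k IH] U square far braid Ule1; first by case=> // _; apply: Ule1.
move=> u; have [c] := ubnP (count_mem k u).
elim: c u => // c IHc u uc uk; have [|u2] := leqP (count_mem k u) 1.
  exact: Ule1.
have [u1 [u' [uE ku1]]] : exists u1 u', u = u1 ++ k :: u' /\ k \notin u1.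
  by apply: split_first; rewrite -has_pred1 has_count ltnW.
have {u2} [b [u3 [u'E kb]]] : exists b u3, u' = b ++ k :: u3 /\ k \notin b.
  apply: split_first; rewrite -has_pred1 has_count.
  by move: u2; rewrite uE count_cat /= eqxx (count_memPn ku1).
move: uc uk; rewrite {}uE {}u'E {u u'}.
rewrite count_cat /= eqxx count_cat /= eqxx (count_memPn ku1) (count_memPn kb).
move=> uc.
rewrite all_cat /= all_cat /= ltnSn /= => /and3P[u1k bk u3k].
apply: (IH (fun b => U (u1 ++ k :: b ++ k :: u3))) (all_ltnS_notin bk kb).
- by move=> a i b'; rewrite -!catA -cat_cons catA; apply: square.
- move=> a i j b' ij; rewrite -!catA /= -!cat_cons !(catA u1); exact: far.
- move=> a i b'; rewrite -!catA /= -!cat_cons !(catA u1); exact: braid.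
move=> {b bk kb IH Ule1} b; case: k => [|k] in IHc uc u1k u3k ku1 *.
  by case: b => // _ _; apply: square.
move=> bk; rewrite leq_eqVlt ltnS leqn0 => /orP[b1|/eqP/count_memPn kb].
  have [v1 [v2 [bE kv1]]] : exists v1 v2, b = v1 ++ k :: v2 /\ k \notin v1.
    by apply: split_first; rewrite -has_pred1 has_count (eqP b1).
  have kv2 : k \notin v2.
    apply/count_memPn; move: b1.
    by rewrite bE count_cat /= eqxx (count_memPn kv1) => /eqP[].
  move: bk; rewrite {}bE {b1} all_cat /= => /and3P[v1k _ v2k].
  have {}v1k := all_ltnS_notin v1k kv1; have {}v2k := all_ltnS_notin v2k kv2.
  rewrite -catA /= -word_commute // catA.
  rewrite -[[:: k.+1, k & _]]/([:: k.+1; k] ++ _) catA word_commute // -catA.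
  have above v : all (fun i => i < k) v -> k.+1 \notin v.
    by move=> /allP vk; apply/negP => /vk; rewrite ltnNge leqnSn.
  apply: braid; apply: IHc.
    rewrite !count_cat /= count_cat eqxx (ltn_eqF (ltnSn k)).
    rewrite (count_memPn ku1) (count_memPn (above _ v1k)).
    rewrite (count_memPn (above _ v2k)).
    by move: uc; lia.
  have wider v : all (fun i => i < k) v -> all (fun i => i < k.+2) v.
    by apply: sub_all => i ik; rewrite ltnS ltnW // ltnW.
  by rewrite !all_cat /= all_cat u1k u3k !wider // ltnSn ltnS leqnSn.
have {}bk := all_ltnS_notin bk kb.
by rewrite -word_commute // catA; apply: square.
Qed.
End PositiveWords.

(** * Number of cycles of the permutation of a braid word *)

Section Cycles.
Variable N' : nat.
Let N := N'.+1.

(** The degree of the permutations is kept fixed while the number of strands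
    varies; a word on fewer strands fixes the remaining points. *)
Definition adjacent_tperm i : 'S_N := tperm (inord i) (inord i.+1).
Definition word_perm (w : word) : 'S_N :=
  foldr (fun x p => (p * adjacent_tperm x.1)%g) 1%g w.
Definition cycles w := #|porbits (word_perm w)|.

Lemma word_perm_cat a b : word_perm (a ++ b) = (word_perm b * word_perm a)%g.
Proof. by elim: a => [|x a IH] /=; rewrite ?mulg1 // IH mulgA. Qed.

Lemma card_porbits_insert (T : finType) (s t : {perm T}) x y :
  (#|porbits (s * tperm x y * t)| +
     ((s^-1 x)%g \notin porbit (s * t) ((s^-1 y)%g)).*2 =
   #|porbits (s * t)| + (x != y))%N.
Proof.
have -> : (s * tperm x y * t = tperm (s^-1 x) (s^-1 y) * (s * t))%g.
  by rewrite -tpermJ conjgE invgK !mulgA mulgKV.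
by rewrite porbits_mul_tperm (inj_eq perm_inj).
Qed.

Lemma inord_eq i j : (i < N)%N -> (j < N)%N ->
  (inord i == inord j :> 'I_N) = (i == j).
Proof. by move=> iN jN; rewrite -val_eqE /= !inordK. Qed.

Lemma cycles_sign a b i o o' :
  cycles (a ++ (i, o) :: b) = cycles (a ++ (i, o') :: b).
Proof. by rewrite /cycles !word_perm_cat. Qed.

Lemma cycles_insert a b i o : (i.+1 < N)%N ->
  cycles (a ++ (i, o) :: b) = (cycles (a ++ b)).+1 \/
  cycles (a ++ b) = (cycles (a ++ (i, o) :: b)).+1.
Proof.
move=> iN; rewrite /cycles !word_perm_cat /=.
have := card_porbits_insert (word_perm b) (word_perm a) (inord i) (inord i.+1).
rewrite inord_eq // 1?ltnW // neq_ltn ltnSn /=; rewrite /adjacent_tperm.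
by case: (_ \notin _) => /=; move: #|_| #|_|; lia.
Qed.

Lemma word_perm_fix n w j : on_strands n w -> (n <= j < N)%N ->
  word_perm w (inord j) = inord j.
Proof.
move=> + /andP[nj jN]; elim: w => [|[i o] w IH] /=; first by rewrite perm1.
move=> /andP[iw /IH {}IH]; rewrite permM IH tpermD // inord_eq //; lia.
Qed.

(** The transposition joins the fixed point [n] to another cycle. *)
Lemma cycles_stab n a b o : (0 < n < N)%N -> on_strands n (a ++ b) ->
  cycles (a ++ b) = (cycles (a ++ (n.-1, o) :: b)).+1.
Proof.
move=> /andP[n0 nN]; rewrite on_strands_cat => /andP[na nb].
have fixn : (word_perm b)^-1%g (inord n) = inord n.
  by rewrite -[in LHS](word_perm_fix nb (j := n)) ?leqnn // permK.
rewrite /cycles !word_perm_cat /=.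
have fix_iter k : ((word_perm b * word_perm a) ^+ k)%g (inord n) = inord n.
  elim: k => [|k IH]; first by rewrite expg0 perm1.
  by rewrite expgSr permM IH permM !(@word_perm_fix n) ?leqnn.
have :=
  card_porbits_insert (word_perm b) (word_perm a) (inord n.-1) (inord n).
rewrite fixn (_ : _ \notin _ = true) /=; last first.
  apply/porbitP => -[k]; rewrite fix_iter => /(canRL (permKV _)).
  by rewrite (word_perm_fix nb) ?leqnn // => /eqP; rewrite inord_eq //; lia.
rewrite inord_eq //; last lia.
rewrite /adjacent_tperm prednK // neq_ltn prednK // leqnn /=.
by move: #|_| #|_|; lia.
Qed.

Lemma cycles_congr a b A B :
  word_perm A = word_perm B -> cycles (a ++ A ++ b) = cycles (a ++ B ++ b).
Proof. by move=> AB; rewrite /cycles !word_perm_cat AB. Qed.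

Lemma word_perm_square i o o' : word_perm [:: (i, o); (i, o')] = 1%g.
Proof. by rewrite /= mul1g; apply: tperm2. Qed.

Lemma word_perm_far i j o o' : (i.+1 < j)%N -> (j.+1 < N)%N ->
  word_perm [:: (i, o); (j, o')] = word_perm [:: (j, o'); (i, o)].
Proof.
move=> ij jN; rewrite /= !mul1g /adjacent_tperm.
apply/esym/commgP/conjg_fixP; rewrite tpermJ.
by rewrite !tpermD // inord_eq //; lia.
Qed.

Lemma word_perm_braid i o : (i.+2 < N)%N ->
  word_perm [:: (i, o); (i.+1, o); (i, o)] =
  word_perm [:: (i.+1, o); (i, o); (i.+1, o)].
Proof.
move=> iN; rewrite /= !mul1g.
have conjT (x y u w : 'I_N) : (tperm x y * tperm u w * tperm x y =
    tperm (tperm x y u) (tperm x y w))%g.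
  by rewrite -tpermJ conjgE tpermV mulgA.
rewrite !conjT tpermL tpermR !tpermD // inord_eq //; lia.
Qed.

End Cycles.

(** * Normalized polynomials of closed braids *)

(** The inner variable is [z], the outer one [t = v ^ 2]. *)
Definition eval2 (S : comNzRingType) (a b : S) : {poly {poly int}} -> S :=
  horner_eval b \o map_poly (horner_eval a \o map_poly intr).

HB.instance Definition _ (S : comNzRingType) (a b : S) :=
  GRing.RMorphism.copy (eval2 a b)
    (horner_eval b \o map_poly (horner_eval a \o map_poly intr)).

Lemma eval2C (S : comNzRingType) (a b : S) p :
  eval2 a b p%:P = (map_poly intr p).[a].
Proof. by rewrite /eval2 /= map_polyC /= /horner_eval hornerC. Qed.

Lemma eval2X (S : comNzRingType) (a b : S) : eval2 a b 'X = b.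
Proof. by rewrite /eval2 /= map_polyX /horner_eval hornerX. Qed.

Local Notation at_z0 := (eval2 (0 : {poly int}) 'X).

Lemma coef_at_z0 (F : {poly {poly int}}) j : (at_z0 F)`_j = F`_j`_0.
Proof.
have -> : at_z0 F = map_poly (horner_eval 0) F.
  rewrite /eval2 /= /horner_eval /= -[RHS]comp_polyXr /comp_poly; congr _.[_].
  rewrite -map_poly_comp; apply: eq_map_poly => p /=.
  by rewrite !horner_coef0 coef_map /= -[in RHS](intz p`_0) rmorph_int.
by rewrite coef_map /= /horner_eval horner_coef0.
Qed.

Definition exponent_sum (w : word) : int :=
  \sum_(x <- w) (if x.2 then 1 else -1).

Lemma exponent_sum_cat a b :
  exponent_sum (a ++ b) = exponent_sum a + exponent_sum b.
Proof. exact: big_cat. Qed.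

Lemma exponent_sum_cons x b :
  exponent_sum (x :: b) = (if x.2 then 1 else -1) + exponent_sum b.
Proof. exact: big_cons. Qed.

Definition homfly_exp n (w : word) : int := exponent_sum w - n%:Z + 1.

Section Represents.
Variables (S : comUnitRingType) (V a : S) (unitV : V \is a GRing.unit).

(** [T] is the value of a link invariant satisfying the skein relation in which
    [V] and [a] stand for [v] and [z].  This is needed for the Homflypt
    polynomial itself and for the constant invariant 1. *)
Definition represents (e : int) mu (F : {poly {poly int}}) (T : S) :=
  a ^+ mu * T = V ^ e * eval2 a (V ^+ 2) F.

(** For [mu + 1] and [mu0 + 1] components before and after a crossing is
    smoothed, [q] is the coefficient of [F0] in the skein relation for [F]. *)
Definition smoothing_factor mu mu0 (q : {poly int}) :=
  mu0 = mu.+1 /\ q = 1 \/ mu = mu0.+1 /\ q = 'X^2.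

Lemma smoothing_factorE mu mu0 q : smoothing_factor mu mu0 q ->
  a ^+ mu0 * (map_poly intr q).[a] = a ^+ mu.+1.
Proof.
case=> -[-> ->]; first by rewrite rmorph1 hornerC mulr1.
by rewrite map_polyXn hornerXn -exprD addn2.
Qed.

Lemma exprz_shift (e : int) k : V ^+ k * V ^ (e - k%:Z) = V ^ e.
Proof. by rewrite -[V ^+ k]/(V ^ k%:Z) -exprzDr // addrC subrK. Qed.

Lemma represents_positive e mu mu0 q F0 F1 T0 T1 T :
    smoothing_factor mu mu0 q -> T = V * a * T0 + V ^+ 2 * T1 ->
    represents (e - 1) mu0 F0 T0 -> represents (e - 2) mu F1 T1 ->
  represents e mu (F1 + q%:P * F0) T.
Proof.
rewrite /represents => /smoothing_factorE qE -> T0E T1E.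
rewrite rmorphD rmorphM /= eval2C mulrDr [RHS]mulrDr -{2}(exprz_shift e 1).
rewrite -{1}(exprz_shift e 2) -[_ * _ * eval2 _ _ F1]mulrA -T1E.
have -> : a ^+ mu * (V * a * T0) = V * (a ^+ mu.+1 * T0) by rewrite exprS; ring.
rewrite -qE [_ * _ * T0]mulrAC T0E; ring.
Qed.

Lemma represents_negative e mu mu0 q F0 F1 T0 T1 T :
    smoothing_factor mu mu0 q -> T1 = V * a * T0 + V ^+ 2 * T ->
    represents (e + 1) mu0 F0 T0 -> represents (e + 2) mu F1 T1 ->
  represents e mu (F1 - q%:P * F0) T.
Proof.
rewrite /represents => /smoothing_factorE qE T1E T0E F1E.
apply: (mulrI (unitrX 2 unitV)).
have -> : V ^+ 2 * (a ^+ mu * T) = a ^+ mu * T1 - V * (a ^+ mu.+1 * T0).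
  by rewrite T1E [a ^+ _.+1]exprS; ring.
rewrite F1E -qE [_ * _ * T0]mulrAC T0E rmorphB rmorphM /= eval2C.
have := exprz_shift (e + 2) 2; rewrite addrK => <-.
have := exprz_shift (e + 1) 1; rewrite addrK => <-; ring.
Qed.

Lemma represents_stab_negative e mu F T :
  represents e mu F T -> represents (e - 2) mu ('X * F) T.
Proof.
rewrite /represents rmorphM /= eval2X => ->.
by rewrite mulrCA mulrA [V ^+ 2 * _](exprz_shift e 2).
Qed.

(** Here [T0] is the value on both stabilizations of a braid, [T] the value on
    the braid with one more strand, which results from smoothing. *)
Lemma represents_strand e mu F T0 T :
    T0 = V * a * T + V ^+ 2 * T0 -> represents e mu F T0 ->
  represents (e - 1) mu.+1 ((1 - 'X) * F) T.
Proof.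
rewrite /represents rmorphM rmorphB rmorph1 /= eval2X => T0E FE.
apply: (mulrI unitV).
have -> : V * (a ^+ mu.+1 * T) = (1 - V ^+ 2) * (a ^+ mu * T0).
  have -> : (1 - V ^+ 2) * (a ^+ mu * T0) = a ^+ mu * (T0 - V ^+ 2 * T0) by ring.
  by rewrite {1}T0E [a ^+ _.+1]exprS; ring.
rewrite FE -(exprz_shift e 1); ring.
Qed.

End Represents.

Section Main.
Variables (P : diagram -> Lvz) (HP : homflypt P) (N' : nat).
Let N := N'.+1.
Local Notation cycles := (cycles N').
Local Notation V := (laurentX int).

Record normalized n (w : word) mu (F : {poly {poly int}}) : Prop := {
  normalized_size : (size F <= n)%N;
  normalized_homfly :
    represents v z (homfly_exp n w) mu F (P (closure n w));
  normalized_one : represents V (V^-1 - V) (homfly_exp n w) mu F 1;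
  normalized_low : exists2 R : {poly int},
    R.[1] = 1 & at_z0 F = (1 - 'X) ^+ mu * R
}.

(** On [n] strands the permutation has the [N - n] fixed points beyond the
    strands among its cycles, so that the closure has [mu + 1] components. *)
Definition has_normalized n w :=
  exists mu F, (cycles w + n)%N = (N + mu).+1 /\ normalized n w mu F.

Lemma unitV : V \is a GRing.unit. Proof. exact: laurentX_unit. Qed.
Lemma unitv : v \is a GRing.unit. Proof. exact: laurentX_unit. Qed.

Lemma one_skein : 1 = V * (V^-1 - V) * 1 + V ^+ 2 * 1 :> laurent int.
Proof. by rewrite !mulr1 mulrBr divrr ?unitV // -expr2 subrK. Qed.

Lemma has_normalized_eq n w w' :
    P (closure n w) = P (closure n w') ->
    exponent_sum w = exponent_sum w' -> cycles w = cycles w' ->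
  has_normalized n w -> has_normalized n w'.
Proof.
move=> PE wE cE [mu [F [cF [? P_ one low]]]]; exists mu, F.
by split; rewrite -?cE //; split; rewrite /homfly_exp -?wE -?PE.
Qed.

(** At [t = 1] the two factors [R] agree: the contribution of the smoothed
    diagram vanishes at [z = 0] or has one more factor [1 - t]. *)
Lemma at_z0_smoothing mu mu0 q
    (F0 F1 : {poly {poly int}}) (R0 R1 : {poly int}) :
    smoothing_factor mu mu0 q -> R1.[1] = 1 ->
    at_z0 F0 = (1 - 'X) ^+ mu0 * R0 -> at_z0 F1 = (1 - 'X) ^+ mu * R1 ->
  (exists2 R, R.[1] = 1 & at_z0 (F1 + q%:P * F0) = (1 - 'X) ^+ mu * R) /\
  (exists2 R, R.[1] = 1 & at_z0 (F1 - q%:P * F0) = (1 - 'X) ^+ mu * R).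
Proof.
move=> smooth R1E F0E F1E; rewrite rmorphB rmorphD rmorphM /= eval2C F0E F1E.
case: smooth => -[-> ->].
  rewrite rmorph1 hornerC; split.
    exists (R1 + (1 - 'X) * R0); first by rewrite !hornerE R1E; ring.
    by rewrite exprS; ring.
  exists (R1 - (1 - 'X) * R0); first by rewrite !hornerE R1E; ring.
  by rewrite exprS; ring.
rewrite map_polyXn hornerXn expr0n /= mul0r addr0 subr0.
by split; exists R1.
Qed.

(** By the skein relation, the sign of a crossing does not matter once the word
    without this crossing is known. *)
Lemma has_normalized_switch n a b i o : (n <= N)%N ->
    on_strands n (a ++ (i, o) :: b) ->
    has_normalized n (a ++ b) -> has_normalized n (a ++ (i, ~~ o) :: b) ->
  has_normalized n (a ++ (i, o) :: b).
Proof.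
move=> nN nw [mu0 [F0 [c0 [s0 P0 one0 [R0 _ low0]]]]].
move=> [mu [F1 [c1 [s1 P1 one1 [R1 R1E low1]]]]].
have [na iN nb] : [/\ on_strands n a, (i.+1 < n)%N & on_strands n b].
  by move: nw; rewrite on_strands_cat => /= /and3P.
have [q qE] : exists q, smoothing_factor mu mu0 q.
  have := cycles_insert a b (~~ o) (leq_trans iN nN).
  move: c0 c1; rewrite -/cycles => c0 c1.
  by case=> cE; [exists 'X^2; right|exists 1; left]; split=> //; lia.
have nwt : on_strands n (a ++ (i, true) :: b).
  by move: nw; rewrite !on_strands_cat.
have skein := closure_skein HP nwt.
have [lowp lown] := at_z0_smoothing qE R1E low0 low1.
have sq : (size (q%:P * F0)%R <= n)%N.
  by rewrite mul_polyC; apply: leq_trans s0; apply: size_scale_leq.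
have expE c : homfly_exp n (a ++ (i, c) :: b) =
    homfly_exp n (a ++ b) + (if c then 1 else -1).
  by rewrite /homfly_exp !exponent_sum_cat exponent_sum_cons /=; ring.
case: o nw c1 P1 one1 skein => /= _ c1 P1 one1 skein.
  exists mu, (F1 + q%:P * F0).
  split; first by rewrite (cycles_sign _ _ _ _ _ false).
  split; last exact: lowp.
  - by rewrite (leq_trans (size_polyD _ _)) // geq_max s1.
  - apply: (represents_positive unitv qE skein).
      by rewrite expE addrK; exact: P0.
    by move: P1; rewrite !expE; congr represents; ring.
  - apply: (represents_positive unitV qE one_skein).
      by rewrite expE addrK; exact: one0.
    by move: one1; rewrite !expE; congr represents; ring.
exists mu, (F1 - q%:P * F0).
split; first by rewrite (cycles_sign _ _ _ _ _ true).
split; last exact: lown.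
- by rewrite (leq_trans (size_polyD _ _)) // geq_max s1 size_polyN.
- apply: (represents_negative unitv qE skein).
    by rewrite expE subrK; exact: P0.
  by move: P1; rewrite !expE; congr represents; ring.
- apply: (represents_negative unitV qE one_skein).
    by rewrite expE subrK; exact: one0.
  by move: one1; rewrite !expE; congr represents; ring.
Qed.

(** A crossing between the new strand and the last one of [w] is smoothed by the
    skein relation; both signs of this crossing give the closure of [w]. *)
Lemma has_normalized_strand n w : (0 < n)%N -> on_strands n w ->
  has_normalized n w -> has_normalized n.+1 w.
Proof.
move=> n0 nw [mu [F [cE [sF Pw one [R R1 low]]]]].
exists mu.+1, ((1 - 'X) * F); split; first lia.
have nw' : on_strands n.+1 (w ++ [:: (n.-1, true)]).
  rewrite on_strands_cat /= prednK // ltnS leqnn !andbT.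
  by apply: sub_all nw => x; apply: ltnW.
have := closure_skein HP nw'; rewrite !cats1 cats0 !closure_stab // => skein.
have eE : homfly_exp n.+1 w = homfly_exp n w - 1.
  by rewrite /homfly_exp -addn1 PoszD; ring.
split.
- apply: (leq_trans (size_polyMleq _ _)).
  by rewrite -opprB size_polyN size_XsubC /= addSn /= ltnS.
- by rewrite eE; apply: (represents_strand unitv skein).
- by rewrite eE; apply: (represents_strand unitV one_skein).
- exists R => //; rewrite rmorphM rmorphB rmorph1 /= eval2X low exprS; ring.
Qed.

(** Conjugation brings the only occurrence of the last generator to the end. *)
Lemma has_normalized_stab n a b o : (0 < n < N)%N -> on_strands n (a ++ b) ->
  has_normalized n (a ++ b) -> has_normalized n.+1 (a ++ (n.-1, o) :: b).
Proof.
move=> nN nw; have n0 : (0 < n)%N by case/andP: nN.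
move=> [mu [F [cE [sF Pw one [R R1 low]]]]].
have cS := cycles_stab o nN nw.
have PE : P (closure n.+1 (a ++ (n.-1, o) :: b)) = P (closure n (a ++ b)).
  have nb : on_strands n (b ++ a).
    by rewrite on_strands_cat andbC -on_strands_cat.
  have nb' : on_strands n.+1 ((a ++ [:: (n.-1, o)]) ++ b).
    have : on_strands n.+1 (a ++ b) by apply: sub_all nw => x; apply: ltnW.
    by rewrite !on_strands_cat /= prednK // ltnS leqnn andbT => /andP[-> ->].
  rewrite -cat_rcons -cats1 closure_rot // catA cats1.
  by rewrite closure_stab // closure_rot.
have eE : homfly_exp n.+1 (a ++ (n.-1, o) :: b) =
    homfly_exp n (a ++ b) - (if o then 0 else 2).
  rewrite /homfly_exp !exponent_sum_cat exponent_sum_cons /= -addn1 PoszD.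
  by case: o {PE cS}; ring.
case: o cS PE eE => cS PE eE.
  exists mu, F; rewrite subr0 in eE; split; first by rewrite addnS -cE cS; lia.
  by split; rewrite ?PE ?eE //; [apply: leqW | exists R].
exists mu, ('X * F); split; first by rewrite addnS -cE cS; lia.
split; rewrite ?PE ?eE.
- apply: (leq_trans (size_polyMleq _ _)).
  by rewrite size_polyX /= addSn /= ltnS.
- exact (represents_stab_negative unitv Pw).
- exact (represents_stab_negative unitV one).
exists ('X * R); first by rewrite !hornerE.
by rewrite rmorphM /= eval2X low mulrCA.
Qed.

Lemma card_porbits1 (T : finType) : #|porbits (1 : {perm T})%g| = #|T|.
Proof.
rewrite card_imset // => x y xy.
have : y \in porbit 1%g x by rewrite xy porbit_id.
case/porbitP=> k ->; rewrite expg1n perm1 //.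
Qed.

Lemma has_normalized_unknot : has_normalized 1 [::].
Proof.
exists 0%N, 1; rewrite /cycles /= card_porbits1 card_ord addn1 addn0; split=> //.
split; last by exists 1; rewrite ?hornerC // rmorph1 expr0 mulr1.
- by rewrite size_poly1.
- rewrite /represents rmorph1 /homfly_exp /exponent_sum big_nil sub0r addNr.
  rewrite expr0z !mulr1 mul1r; exact: (homflypt_unknot HP).
- rewrite /represents rmorph1 /homfly_exp /exponent_sum big_nil sub0r addNr.
  by rewrite expr0z !mulr1.
Qed.

Lemma unzip1_cat (w : word) a c : unzip1 w = a ++ c ->
  exists wa wc, [/\ w = wa ++ wc, unzip1 wa = a & unzip1 wc = c].
Proof.
move=> wE; exists (take (size a) w), (drop (size a) w).
by rewrite cat_take_drop /unzip1 map_take map_drop [map _ _]wE take_size_cat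
  ?drop_size_cat.
Qed.

(** When all shorter words are known, the signs of the crossings do not matter,
    so that only the underlying positive word has to be simplified. *)
Lemma has_normalized_step n L : (0 < n < N)%N ->
    (forall w, on_strands n w -> has_normalized n w) ->
    (forall w, (size w < L)%N -> on_strands n.+1 w -> has_normalized n.+1 w) ->
  forall w, size w = L -> on_strands n.+1 w -> has_normalized n.+1 w.
Proof.
move=> nN IHn IHL w sw nw.
have n0 : (0 < n)%N by case/andP: nN.
have nN' : (n < N)%N by case/andP: nN.
have resign a b i o c : (size (a ++ (i, o) :: b) <= L)%N ->
    on_strands n.+1 (a ++ (i, o) :: b) ->
    has_normalized n.+1 (a ++ (i, c) :: b) ->
    has_normalized n.+1 (a ++ (i, o) :: b).
  case: (eqVneq o c) => [<- //|oc sL nab Hc].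
  apply: has_normalized_switch => //; last by case: o c oc Hc {sL nab} => -[].
  apply: IHL; first by move: sL; rewrite !size_cat addnS.
  by move: nab; rewrite !on_strands_cat => /= /and3P[-> _ ->].
(* [U u]: all words of length [L] with the generators [u], in any signs, have a
   normal form. *)
pose U u := forall w, unzip1 w = u -> size w = L -> on_strands n.+1 w ->
  has_normalized n.+1 w.
suff /(_ w erefl sw nw) : U (unzip1 w) by [].
have nU : all (fun i => i < n)%N (unzip1 w) by rewrite all_map.
apply: top_generator_ind nU => {w sw nw}.
- (* A repeated letter is given opposite signs and cancelled. *)
  move=> a i b w /unzip1_cat[wa [[|[j o] [|[k o'] wb]] [-> _]]] //=.
  move=> [-> -> _] {j k} sL nw; apply: (resign _ _ _ _ (~~ o')); rewrite ?sL //.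
  have nw' : on_strands n.+1 (wa ++ [:: (i, ~~ o'), (i, ~~ ~~ o') & wb]).
    by move: nw; rewrite !on_strands_cat.
  have nab : on_strands n.+1 (wa ++ wb).
    by move: nw; rewrite !on_strands_cat /= => /and4P[-> _ _ ->].
  apply: has_normalized_eq (IHL _ _ nab).
  + by rewrite -(closure_R2 HP nw') negbK.
  + rewrite !exponent_sum_cat !exponent_sum_cons /=.
    by case: o' {nw nw' sL} => /=; ring.
  + by apply: (@cycles_congr _ _ _ [::] [:: _; _]); rewrite word_perm_square.
  by move: sL; rewrite !size_cat /=; lia.
- have far a i j b : (i.+1 < j)%N || (j.+1 < i)%N ->
      U (a ++ [:: i, j & b]) -> U (a ++ [:: j, i & b]).
    move=> ij Uij w /unzip1_cat[wa [[|[j' o] [|[i' o'] wb]] [-> wE]]] //=.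
    move=> [-> -> bE] {i' j'} sL nw.
    have nw' : on_strands n.+1 (wa ++ [:: (i, o'), (j, o) & wb]).
      by move: nw; rewrite !on_strands_cat /= => /and4P[-> -> -> ->].
    have [iN jN] : (i.+1 < N)%N /\ (j.+1 < N)%N.
      by move: nw; rewrite on_strands_cat /= => /and4P[_ jn i_n _]; split; lia.
    apply: (@has_normalized_eq _ (wa ++ [:: (i, o'), (j, o) & wb])).
    + by case/orP: ij => ij; [|apply/esym]; apply: (closure_far HP).
    + by rewrite !exponent_sum_cat !exponent_sum_cons; ring.
    + apply: (@cycles_congr _ _ _ [:: _; _] [:: _; _]).
      by case/orP: ij => ij; [|apply/esym]; apply: word_perm_far.
    by apply: Uij; rewrite // -?sL ?size_cat // /unzip1 map_cat -wE -bE.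
  by move=> a i j b ij; split; apply: far; rewrite ij ?orbT.
- (* All signs are made positive before the braid relation is used. *)
  move=> a i b Ui w.
  case/unzip1_cat=> [wa [[|[i1 o1] [|[i2 o2] [|[i3 o3] wb]]] [-> wE]]] //=.
  move=> [-> -> -> bE] {i1 i2 i3} sL nw.
  have nwo c1 c2 c3 :
      on_strands n.+1 (wa ++ [:: (i.+1, c1), (i, c2), (i.+1, c3) & wb]).
    by move: nw; rewrite !on_strands_cat.
  have iN : (i.+2 < N)%N.
    by move: nw; rewrite on_strands_cat /= => /and3P[_ i_n _]; lia.
  have sLo c1 c2 c3 :
      size (wa ++ [:: (i.+1, c1), (i, c2), (i.+1, c3) & wb]) = L.
    by rewrite -sL !size_cat.
  apply: (resign _ _ _ _ true); rewrite ?sLo //.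
  rewrite -cat_rcons; apply: (resign _ _ _ _ true); rewrite ?cat_rcons ?sLo //.
  rewrite -cat_rcons -cat_rcons; apply: (resign _ _ _ _ true);
    rewrite ?cat_rcons ?sLo //.
  have nw' :
      on_strands n.+1 (wa ++ [:: (i, true), (i.+1, true), (i, true) & wb]).
    by move: nw; rewrite !on_strands_cat /= => /and5P[-> -> -> _ ->].
  apply: (@has_normalized_eq _
      (wa ++ [:: (i, true), (i.+1, true), (i, true) & wb])).
  + exact: (closure_R3 HP).
  + by rewrite !exponent_sum_cat !exponent_sum_cons; ring.
  + apply: (@cycles_congr _ _ _ [:: _; _; _] [:: _; _; _]).
    exact: word_perm_braid.
  by apply: Ui; rewrite // -?sL ?size_cat // /unzip1 map_cat -wE -bE.
have nP: n = n.-1.+1 by rewrite prednK.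
have lower w : all (fun i => i < n)%N (unzip1 w) -> n.-1 \notin unzip1 w ->
    on_strands n w.
  rewrite {1}nP => un top; have := all_ltnS_notin un top.
  by rewrite all_map; apply: sub_all => x /=; rewrite ltn_predRL.
move=> u un u1 w wu sL nw; rewrite -{}wu in un u1.
move: u1; rewrite leq_eqVlt ltnS leqn0.
case/orP=> [u1|/eqP/count_memPn top]; last first.
  by have wn := lower _ un top; apply: has_normalized_strand => //; apply: IHn.
have : n.-1 \in unzip1 w by rewrite -has_pred1 has_count (eqP u1).
case/split_first=> a [b [wE top_a]].
move: un u1; rewrite wE all_cat count_cat /= eqxx => /and3P[an _ bn].
rewrite (count_memPn top_a) => /eqP[/count_memPn top_b].
have [wa [[|[j o] wb] [wE' aE //]]] := unzip1_cat wE.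
move=> /= [jE bE]; rewrite {}wE' {}jE.
have wab : on_strands n (wa ++ wb).
  rewrite -aE in an top_a; rewrite -bE in bn top_b.
  by rewrite on_strands_cat !lower.
by apply: has_normalized_stab => //; apply: IHn.
Qed.

Lemma braid_has_normalized n w :
  (0 < n <= N)%N -> on_strands n w -> has_normalized n w.
Proof.
case: n => // n; elim: n w => [|n IHn] w nN.
  by case: w => // _; apply: has_normalized_unknot.
have [L] := ubnP (size w); elim: L w => // L IHL w wL nw.
apply: (@has_normalized_step _ (size w)) => // [w' nw'|w' w'w nw'].
  by apply: IHn => //; apply: ltnW.
by apply: IHL => //; apply: leq_trans w'w _.
Qed.

End Main.

(** * Components of a closed braid *)

Section Components.
Variable N' : nat.
Let N := N'.+1.
Local Open Scope nat_scope.

Lemma iota0S k : iota 0 k.+1 = iota 0 k ++ [:: k].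
Proof. by rewrite -addn1 iotaD. Qed.

Lemma components_cups k m D :
  components_rec k (iota 0 k ++ rev (iota 0 k))
    ([seq (i, cup true) | i <- iota k m] ++ D) =
  components_rec (k + m) (iota 0 (k + m) ++ rev (iota 0 (k + m))) D.
Proof.
elim: m k => [|m IH] k /=; first by rewrite addn0.
rewrite take_size_cat ?size_iota // drop_size_cat ?size_iota //.
by rewrite addnS -addSn -IH iota0S rev_cat -catA.
Qed.

(** During the sweep the left half of a level is a permuted copy of the labels
    on its right half. *)
Definition labels (p : 'S_N) k := mkseq (fun j => val (p (inord j))) k.

Lemma labels_adjacent_tperm (p : 'S_N) i k : i.+1 < k <= N ->
  labels (adjacent_tperm N' i * p)%g k =
  take i (labels p k) ++
    [:: nth 0 (labels p k) i.+1, nth 0 (labels p k) i & drop i.+2 (labels p k)].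
Proof.
move=> /andP[ik kN].
rewrite !nth_mkseq ?(ltnW ik) // /labels /mkseq.
have -> : k = i + (2 + (k - i.+2)) by lia.
rewrite !iotaD !map_cat take_size_cat ?size_map ?size_iota //.
rewrite !catA (@drop_size_cat _ _ (_ ++ _)); last first.
  by rewrite size_cat !size_map !size_iota addn2.
rewrite -!catA add0n; congr (_ ++ _).
  apply/eq_in_map => j; rewrite mem_iota /= => ji.
  rewrite permM tpermD // inord_eq //; lia.
rewrite /= !permM tpermL tpermR; congr [:: _, _ & _].
apply/eq_in_map => j; rewrite mem_iota => ji.
by rewrite permM tpermD // inord_eq //; lia.
Qed.

Lemma components_crossings K (p : 'S_N) w r D : on_strands N w ->
  components_rec K (labels p N ++ r) (crossings w ++ D) =
  components_rec K (labels (word_perm N' w * p) N ++ r) D.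
Proof.
elim: w p => [|[i o] w IH] p; first by rewrite mul1g.
case/andP=> iN /IH {}IH; rewrite [(i, o).1]/= in iN.
have crossE s E : components_rec K s ((i, cross o) :: E) = components_rec K
  (take i s ++ [:: nth 0 s i.+1, nth 0 s i & drop i.+2 s]) E by [].
rewrite [crossings _]/= cat_cons crossE [word_perm _ _]/= -mulgA -IH.
rewrite labels_adjacent_tperm ?iN ?leqnn //.
have sL : size (labels p N) = N by rewrite size_mkseq.
rewrite !nth_cat sL iN (ltnW iN) take_cat sL (ltnW iN).
rewrite drop_cat sL -catA !cat_cons.
congr (components_rec _ (_ ++ [:: _, _ & _]) _).
case: ltnP => // iN2; rewrite [drop i.+2 (labels _ _)]drop_oversize ?sL //.
have -> : i.+2 - N = 0 by lia.
by rewrite drop0.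
Qed.

(** The innermost cap removes the point [k] from its cycle, as multiplication by
    a transposition does up to the new fixed point [k].  It closes a component
    iff [k] was a fixed point before. *)
Lemma components_caps K k (p : 'S_N) : k <= N ->
    (forall j, k <= j < N -> p (inord j) = inord j) ->
  components_rec K (labels p k ++ rev (iota 0 k)) (caps k) + (N - k) =
  #|porbits p|.
Proof.
elim: k p => [|k IH] p kN pfix.
  have -> : p = 1%g.
    by apply/permP => j; rewrite perm1 -{1}(inord_val j) pfix ?inord_val //=.
  by rewrite card_porbits1 card_ord subn0.
have sL : size (labels p k) = k by rewrite size_mkseq.
have labelsS : labels p k.+1 = labels p k ++ [:: val (p (inord k))].
  by rewrite /labels /mkseq iota0S map_cat.
have iotaS : rev (iota 0 k.+1) = k :: rev (iota 0 k).
  by rewrite iota0S rev_cat.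
rewrite capsS labelsS iotaS -catA /=.
rewrite !nth_cat sL ltnn subnn ltnNge leqnSn /= subSn // subnn /=.
rewrite take_size_cat // drop_cat sL ltnNge -addn2 leq_addr /= addKn /= drop0.
pose q := (p * tperm (inord k) (p (inord k)))%g.
have -> : [seq if c == k then val (p (inord k)) else c
    | c <- labels p k ++ rev (iota 0 k)] = labels q k ++ rev (iota 0 k).
  rewrite map_cat; congr (_ ++ _).
    rewrite -map_comp; apply/eq_in_map => j; rewrite mem_iota /= => jk.
    rewrite permM; case: tpermP.
    + by move=> ->; rewrite inordK // eqxx.
    + by move=> /perm_inj/eqP; rewrite inord_eq; lia.
    + by move=> /eqP; rewrite -val_eqE /= inordK // => /negbTE ->.
  rewrite -[RHS]map_id; apply/eq_in_map => c.
  by rewrite mem_rev mem_iota /= => ck; rewrite ltn_eqF.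
have qfix j : k <= j < N -> q (inord j) = inord j.
  move=> /andP[]; rewrite leq_eqVlt => /orP[/eqP <- _|kj jN].
    by rewrite permM tpermR.
  have pj : p (inord j) = inord j by rewrite pfix ?kj.
  have kj' : inord k != inord j :> 'I_N by rewrite inord_eq // ltn_eqF.
  by rewrite permM pj tpermD // -pj (inj_eq perm_inj).
have := card_porbits_insert p 1 (inord k) (p (inord k)).
rewrite !mulg1 permK (_ : _ \notin _ = false) ?addn0; last first.
  apply/negbF; rewrite porbit_sym.
  by have := mem_porbit p 1 ((p^-1)%g (inord k)); rewrite expg1 permKV.
rewrite -/q -(IH q (ltnW kN) qfix) -val_eqE /= inordK // eq_sym.
by case: eqVneq => _ /=; lia.
Qed.

Lemma components_closure w :
  on_strands N w -> components (closure N w) = cycles N' w.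
Proof.
move=> nw; rewrite /components /closure /cups (components_cups 0 N).
have -> : iota 0 N = labels 1 N.
  rewrite -[LHS]map_id; apply/eq_in_map => j; rewrite mem_iota /= => jN.
  by rewrite perm1 inordK.
rewrite components_crossings // mulg1.
have -> : labels 1 N = iota 0 N.
  rewrite -[RHS]map_id; apply/eq_in_map => j; rewrite mem_iota /= => jN.
  by rewrite perm1 inordK.
have := @components_caps (0 + N) N (word_perm N' w) (leqnn N).
rewrite subnn addn0; apply=> j.
by case/andP=> Nj; rewrite ltnNge Nj.
Qed.
End Components.

(** * Reading off coefficients *)

Section LaurentPoly.
Variable R : idomainType.

Lemma laurent_poly_is_zmod_morphism : zmod_morphism (@laurent_poly R).
Proof. by move=> p q; apply: val_inj; rewrite /= rmorphB. Qed.

Lemma laurent_poly_is_monoid_morphism : monoid_morphism (@laurent_poly R).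
Proof. by split=> [|p q]; apply: val_inj; rewrite /= ?rmorph1 ?rmorphM. Qed.

HB.instance Definition _ := GRing.isZmodMorphism.Build {poly R} (laurent R)
  (@laurent_poly R) laurent_poly_is_zmod_morphism.
HB.instance Definition _ := GRing.isMonoidMorphism.Build {poly R} (laurent R)
  (@laurent_poly R) laurent_poly_is_monoid_morphism.

Lemma laurent_poly_eq0 (p : {poly R}) : laurent_poly p = 0 -> p = 0.
Proof.
by move=> /(congr1 val) /eqP; rewrite /= tofrac_eq0 => /eqP.
Qed.

Lemma lcoef_laurentC c (f : laurent R) i :
  lcoef (laurentC c * f) i = c * lcoef f i.
Proof.
have [[k p] /= fp] := laurent_has_repr f.
rewrite (lcoefE fp) (lcoefE (k := k) (p := c%:P * p)); last first.
  by rewrite /laurent_repr rmorphM /= -mulrA fp -rmorphM.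
by case: (i + k%:Z) => a; rewrite ?coefCM ?mulr0.
Qed.

Lemma lcoef_eq_poly (h : laurent R) (f : {poly R}) mu i :
    laurentX R ^+ mu * h = laurent_poly f ->
  lcoef h i = if i + mu%:Z is Posz a then f`_a else 0.
Proof.
move=> hf; apply: lcoefE.
rewrite /laurent_repr mulrC -[RHS]/(val (laurent_poly f)) -hf.
by rewrite !rmorphM !rmorphXn.
Qed.

End LaurentPoly.

Section Evaluation.
Variable S : comNzRingType.

Lemma eval2_wide m D (a b : S) (F : {poly {poly int}}) :
    (size F <= m)%N -> (forall j, size (F`_j)%R <= D)%N ->
  eval2 a b F = \sum_(j < m) (\sum_(i < D) (F`_j`_i)%:~R * a ^+ i) * b ^+ j.
Proof.
move=> sF sFj; rewrite /eval2 /= {1}/horner_eval.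
rewrite (@horner_coef_wide _ m); last exact: leq_trans (size_poly _ _) sF.
apply: eq_bigr => j _; rewrite coef_map /= /horner_eval.
rewrite (@horner_coef_wide _ D); last exact: leq_trans (size_poly _ _) (sFj j).
by congr (_ * _); apply: eq_bigr => i _; rewrite coef_map.
Qed.

Lemma rmorph_horner (phi : {rmorphism {poly int} -> S}) p :
  phi p = (map_poly intr p).[phi 'X].
Proof.
rewrite (@horner_coef_wide _ (size p)) ?size_poly // -{1}[p]coefK poly_def.
rewrite rmorph_sum; apply: eq_bigr => i _.
by rewrite -mul_polyC rmorphM rmorphXn coef_map -[p`_i in LHS]intz !rmorph_int.
Qed.

(** Evaluations are the only ring morphisms on integral polynomials; this
    identifies [eval2] with maps that are built in another way. *)
Lemma rmorph_eval2 (phi : {rmorphism {poly {poly int}} -> S}) F :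
  phi F = eval2 (phi 'X%:P) (phi 'X) F.
Proof.
rewrite /eval2 /= {1}/horner_eval (@horner_coef_wide _ (size F)) ?size_poly //.
rewrite -{1}[F]coefK poly_def rmorph_sum; apply: eq_bigr => j _.
rewrite -mul_polyC rmorphM rmorphXn coef_map /=; congr (_ * _).
exact: (rmorph_horner (phi \o polyC)).
Qed.

End Evaluation.

Definition substitute (F : {poly {poly int}}) : {poly Lz} :=
  map_poly (@laurent_poly int) F \Po 'X^2.

Lemma eval2_zv F : eval2 z (v ^+ 2) F = laurent_poly (substitute F).
Proof.
have := rmorph_eval2
  (@laurent_poly Lz \o comp_poly 'X^2 \o map_poly (@laurent_poly int)) F.
by rewrite /= map_polyC map_polyX /= comp_polyC comp_polyX rmorphXn => ->.
Qed.

Lemma coef_substitute F i :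
  (substitute F)`_i = if (2 %| i)%N then laurent_poly F`_(i %/ 2) else 0.
Proof. by rewrite coef_comp_poly_Xn //; case: ifP => // _; rewrite coef_map. Qed.

Lemma lcoef_represents e mu F (T : Lvz) i : represents v z e mu F T ->
  laurentX int ^+ mu * lcoef T i =
  if i - e is Posz a then (substitute F)`_a else 0.
Proof.
rewrite /represents eval2_zv -lcoef_shift => <-.
elim: mu => [|mu IH]; first by rewrite !mul1r.
by rewrite !exprS -!mulrA lcoef_laurentC IH.
Qed.

Lemma lcoef_represents_double e mu F (T : Lvz) j : represents v z e mu F T ->
  laurentX int ^+ mu * lcoef T (e + 2 * j%:Z) = laurent_poly F`_j.
Proof.
move=> FT; rewrite (lcoef_represents _ FT) addrC addKr -PoszM.
by rewrite coef_substitute dvdn_mulr // mulnC mulnK.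
Qed.

Lemma lcoef_represents_even e mu F (T : Lvz) j k : represents v z e mu F T ->
  lcoef (lcoef T (e + 2 * j%:Z)) k =
  if k + mu%:Z is Posz a then F`_j`_a else 0.
Proof. by move=> FT; apply/lcoef_eq_poly/lcoef_represents_double. Qed.

Lemma laurentX_neq0 mu : laurentX int ^+ mu != 0.
Proof.
apply: expf_neq0; apply: contraTneq (laurentX_unit int) => ->.
by rewrite unitr0.
Qed.

Lemma lcoef_represents_eq0 e mu F (T : Lvz) j : represents v z e mu F T ->
  lcoef T (e + 2 * j%:Z) = 0 <-> F`_j = 0.
Proof.
move=> /(lcoef_represents_double j) FT; split=> [T0|Fj].
  by apply: laurent_poly_eq0; rewrite -FT T0 mulr0.
move: FT; rewrite Fj rmorph0 => /eqP.
by rewrite mulf_eq0 (negbTE (laurentX_neq0 _)) => /eqP.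
Qed.

Lemma lcoef_represents_neq0 e mu F (T : Lvz) i : represents v z e mu F T ->
  lcoef T i <> 0 -> exists2 j, i = e + 2 * j%:Z & F`_j <> 0.
Proof.
move=> FT Ti; have := lcoef_represents i FT.
have XTi : laurentX int ^+ mu * lcoef T i != 0.
  by rewrite mulf_neq0 ?laurentX_neq0 //; apply/eqP.
case E: (i - e) => [a|a] iE; last by rewrite iE eqxx in XTi.
rewrite coef_substitute in iE; case: ifP iE => [/dvdnP[j aE] iE|_ iE].
  have ij : i = e + 2 * j%:Z by rewrite -PoszM mulnC -aE -E addrC subrK.
  by exists j => // /(lcoef_represents_eq0 j FT); rewrite -ij.
by rewrite iE eqxx in XTi.
Qed.

(** * The lowest term and the span *)

Local Notation V := (laurentX int).

Lemma low_coefs_Xsub1M (R : nzRingType) m mu (p : {poly R}) :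
    (forall j, (j < m)%N -> ((1 - 'X) ^+ mu * p)`_j = 0) ->
  forall j, (j < m)%N -> p`_j = 0.
Proof.
elim: mu => [|mu IH]; first by rewrite expr0 mul1r.
rewrite exprS -mulrA => low; apply: IH => j.
elim: j => [|j IHj] jm; have := low _ jm; rewrite mulrBl mul1r coefB coefXM /=.
  by rewrite subr0.
by rewrite IHj ?subr0 // ltnW.
Qed.

Section LowestTerm.
Variables (F : {poly {poly int}}) (m : nat).
Hypothesis F_low : forall j, (j < m)%N -> F`_j = 0.

(** The nonzero multiple [(1 - t) ^+ mu * R] has no terms below [t ^+ m], hence
    neither has [R]; compare degrees. *)
Lemma components_le_span M mu (R : {poly int}) :
    (size F <= M.+1)%N -> R.[1] = 1 -> at_z0 F = (1 - 'X) ^+ mu * R ->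
  (mu + m <= M)%N.
Proof.
move=> sF R1 F0E.
have R0 : R != 0.
  by apply: contra_eq_neq R1 => ->; rewrite horner0 eq_sym oner_eq0.
have sR : (m < size R)%N.
  rewrite ltnNge; apply/negP => Rm; move/negP: R0; apply.
  apply/eqP/polyP => j; rewrite coef0.
  have [jm|mj] := ltnP j m; last exact/nth_default/(leq_trans Rm).
  apply: (low_coefs_Xsub1M (mu := mu) (m := m)) jm => {}j jm.
  by rewrite -F0E coef_at_z0 F_low // coef0.
have : (size (at_z0 F) <= M.+1)%N.
  apply/leq_sizeP => j Mj; rewrite coef_at_z0 [F`_j]nth_default ?coef0 //.
  exact: leq_trans sF Mj.
have X1E : 1 - 'X = - 1 *: ('X - 1%:P) :> {poly int} by rewrite scaleN1r opprB.
rewrite F0E X1E exprZn -scalerAl size_scale ?signr_eq0 //.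
rewrite size_mul ?expf_neq0 ?polyXsubC_eq0 // size_exp_XsubC.
move=> sM; rewrite -ltnS; apply: leq_trans sM.
by rewrite addSn -addnS leq_add2l.
Qed.

(** Multiplication by [V ^+ D] turns [z ^+ a] into the polynomial
    [(1 - V ^+ 2) ^+ a * V ^+ (D - a)], whose constant term is 0 unless [a = D].
    So the lowest term of the left side is [F`_m`_D] at [e + 2 * m], and that of
    the right side is 1 at [D - mu]. *)
Lemma lowest_term D e mu :
    (forall j, size (F`_j)%R <= D.+1)%N -> F`_m`_D != 0 ->
    represents V (V^-1 - V) e mu F 1 ->
  e + 2 * m%:Z = D%:Z - mu%:Z /\ F`_m`_D = 1.
Proof.
move=> sF FmD FE.
pose g j := \sum_(a < D.+1) F`_j`_a *: ((1 - 'X^2) ^+ a * 'X^(D - a)).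
pose G := \sum_(j < size F) 'X^(2 * j) * g j.
have g0 j : (g j)`_0 = F`_j`_D.
  have X0 : (1 - 'X^2 : {poly int}).[0] = 1 by rewrite !hornerE.
  rewrite -horner_coef0 horner_sum (bigD1 ord_max) //= big1 ?addr0 => [|a aD].
    by rewrite subnn expr0 mulr1 hornerZ horner_exp X0 expr1n mulr1.
  have {}aD : (D - a)%N != 0%N.
    by rewrite subn_eq0 -ltnNge ltn_neqAle aD -ltnS /=.
  by rewrite hornerZ hornerM horner_exp X0 hornerXn expr0n (negbTE aD) !mulr0.
have Glow i : (i <= 2 * m)%N -> G`_i = if i == (2 * m)%N then F`_m`_D else 0.
  move=> im; rewrite /G coef_sum.
  have term j : ('X^(2 * j) * g j)`_i =
      if (i == 2 * m)%N && (j == m) then F`_m`_D else 0.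
    rewrite coefXnM; have [jm|mj] := ltnP j m.
      rewrite (ltn_eqF jm) andbF /g F_low // big1 ?coef0 ?if_same // => a _.
      by rewrite coef0 scale0r.
    case: (eqVneq j m) mj => [-> _|jm mj]; last first.
      by rewrite andbF ifT //; lia.
    rewrite andbT; case: (eqVneq i (2 * m)%N) => [->|im'].
      by rewrite ltnn subnn g0.
    by rewrite ifT // ltn_neqAle im'.
  have mF : (m < size F)%N.
    by rewrite ltnNge; apply: contra FmD => ?; rewrite [F`_m]nth_default ?coef0.
  rewrite (eq_bigr _ (fun (j : 'I_(size F)) _ => term j)).
  rewrite (bigD1 (Ordinal mF)) //= eqxx andbT big1 ?addr0 // => j.
  by rewrite -val_eqE /= => /negbTE ->; rewrite andbF.
have VV : V * V^-1 = 1 by rewrite divrr ?laurentX_unit.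
have gE j : laurent_poly (g j) =
    V ^+ D * \sum_(a < D.+1) (F`_j`_a)%:~R * (V^-1 - V) ^+ a.
  rewrite /g rmorph_sum mulr_sumr; apply: eq_bigr => a _.
  rewrite -mul_polyC 2!rmorphM !rmorphXn rmorphB rmorph1 rmorphXn /=.
  rewrite -[F`_j`_a in LHS]intz !rmorph_int [RHS]mulrCA; congr (_ * _).
  have aD : (a <= D)%N by rewrite -ltnS.
  rewrite -[in X in _ = X * _](subnK aD) exprD [LHS]mulrC -mulrA -exprMn.
  by rewrite mulrBr VV -expr2.
have GE : V ^ e * laurent_poly G =
    V ^ (D%:Z - mu%:Z) * laurent_poly ((1 - 'X^2) ^+ mu).
  have -> : laurent_poly G = V ^+ D * eval2 (V^-1 - V) (V ^+ 2) F.
    rewrite /G (eval2_wide _ _ (leqnn _) sF) rmorph_sum mulr_sumr.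
    apply: eq_bigr => j _.
    by rewrite rmorphM rmorphXn /= gE exprM mulrC -mulrA.
  rewrite mulrCA -FE mulr1 rmorphXn rmorphB rmorph1 rmorphXn /=.
  rewrite exprzDr ?laurentX_unit // -mulrA; congr (_ * _).
  rewrite -exprnN -exprVn -exprMn mulrBr mulr1 expr2 mulrA.
  by rewrite [V^-1 * V]mulrC VV mul1r.
have lcE i : (if i - e is Posz a then G`_a else 0) =
    (if i - (D%:Z - mu%:Z) is Posz a
     then ((1 - 'X^2) ^+ mu : {poly int})`_a else 0).
  by rewrite -!lcoef_shift GE.
have c0 : ((1 - 'X^2) ^+ mu : {poly int})`_0 = 1.
  by rewrite -horner_coef0 horner_exp !hornerE expr1n.
have := lcE (e + 2 * m%:Z); rewrite addrC addKr -PoszM Glow // eqxx.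
case xE: (e + _ - _) => [a|a] FmDE; last by rewrite FmDE eqxx in FmD.
have := lcE (D%:Z - mu%:Z); rewrite subrr.
rewrite -[X in _ = X]/(((1 - 'X^2) ^+ mu : {poly int})`_0) c0.
case zE: (_ - e) => [b|b] // Gb.
have mb : (2 * m <= b)%N.
  rewrite leqNgt; apply/negP => bm; move: Gb.
  by rewrite Glow ?(ltn_eqF bm) // ltnW.
have a0 : a = 0%N by lia.
by split; [lia | rewrite FmDE a0].
Qed.
End LowestTerm.

(** * Degrees of the Homflypt polynomial *)

Definition word_of n (beta : braid_word n) : word :=
  [seq (val x.1, x.2) | x <- beta].

Lemma braid_closureE n (beta : braid_word n) :
  braid_closure beta = closure n (word_of beta).
Proof. by rewrite /closure /crossings /word_of -map_comp. Qed.

Lemma on_strands_word_of n (beta : braid_word n) : on_strands n (word_of beta).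
Proof.
by apply/allP => _ /mapP[[i o] _ ->] /=; have := ltn_ord i; rewrite ltn_predRL.
Qed.

Lemma exponent_sum_word_of n (beta : braid_word n) :
  exponent_sum (word_of beta) = writhe beta.
Proof. by rewrite /exponent_sum /word_of big_map. Qed.

Theorem corollary2p5 (P : diagram -> Lvz) (HP : homflypt P)
  (n : nat) (n_gt0 : (0 < n)%N) (beta : braid_word n)
  (h := mfw beta (P (braid_closure beta))) (m M : 'I_n) (zeta x y : int)
  (hm : first_proper h m) (hM : last_proper h M)
  (hzeta : degz_is (P (braid_closure beta)) zeta)
  (hx : mindegv_is (P (braid_closure beta)) x)
  (hy : degv_is (P (braid_closure beta)) y)
  (hattains : deg_is (h m) zeta)
  (mu := (components (braid_closure beta))%:Z) :
  [/\ zeta = x, lmonic (h m) &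
      y >= Num.max (2 * (M%:Z - m%:Z) + 1 - mu) (mu - 1)].
Proof.
case: n n_gt0 beta @h m M hm hM hzeta hx hy hattains @mu => // n _ beta.
set w := word_of beta; rewrite braid_closureE -/w.
move=> h m M hm hM hzeta hx hy hattains mu.
have nw : on_strands n.+1 w := on_strands_word_of beta.
have [] := @braid_has_normalized P HP n n.+1 w _ nw; first by rewrite leqnn.
move=> mu1 [F [cE [sF FP F1 [R R1 F0E]]]].
have muE : mu = mu1%:Z + 1.
  rewrite /mu components_closure //; lia.
pose Q := P (closure n.+1 w).
pose e := homfly_exp n.+1 w.
have hE j : h j = lcoef Q (e + 2 * j%:Z).
  by rewrite /h /mfw /e /homfly_exp exponent_sum_word_of.
have hcoef j k : lcoef (h j) k = if k + mu1%:Z is Posz a then F`_j`_a else 0.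
  by rewrite hE (lcoef_represents_even _ _ FP).
have h0 j : (h j <> 0) <-> (F`_j <> 0).
  by rewrite hE; split=> + E0; apply; apply/(lcoef_represents_eq0 _ FP).
have F_lt_n j : F`_j <> 0 -> (j < n.+1)%N.
  move=> Fj; rewrite ltnNge; apply/negP => jn; apply: Fj.
  by rewrite nth_default // (leq_trans sF).
have Qsupp i :
    lcoef Q i <> 0 -> exists2 j : 'I_n.+1, i = e + 2 * j%:Z & h j <> 0.
  move=> /(lcoef_represents_neq0 FP)[j ij Fj]; have jn := F_lt_n _ Fj.
  by exists (Ordinal jn) => //; apply/h0.
have [hm0 hm_min] := hm; have [hM0 hM_max] := hM.
have xE : x = e + 2 * m%:Z.
  have [/Qsupp[j xj hj] xmin] := hx.
  have := xmin (e + 2 * m%:Z); rewrite /vexp_in -hE => /(_ hm0).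
  have := hm_min _ hj; rewrite xj; lia.
have yE : e + 2 * M%:Z <= y.
  by have [_ ymax] := hy; apply: ymax; rewrite /vexp_in -hE.
have F_low j : (j < m)%N -> F`_j = 0.
  move=> jm; apply/eqP/negPn/negP => /eqP Fj.
  have jn : (j < n.+1)%N by apply: ltn_trans jm _.
  by have /h0/hm_min := Fj : F`_(Ordinal jn) <> 0; rewrite leqNgt jm.
have sM : (size F <= M.+1)%N.
  apply/leq_sizeP => j Mj; apply/eqP/negPn/negP => /eqP Fj.
  have jn := F_lt_n _ Fj.
  by have /h0/hM_max := Fj : F`_(Ordinal jn) <> 0; rewrite leqNgt Mj.
have [D zetaE FmD] : exists2 D, zeta + mu1%:Z = Posz D & F`_m`_D != 0.
  have [] := hattains; rewrite /zexp hcoef.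
  by case: (zeta + _) => [D|//] /eqP FmD _; exists D.
have sFj j : (size (F`_j)%R <= D.+1)%N.
  apply/leq_sizeP => a Da; apply/eqP/negPn/negP => /eqP Fja.
  have [_ zmax] := hzeta.
  suff /zmax : zexp_in Q (a%:Z - mu1%:Z) by lia.
  exists (e + 2 * j%:Z); rewrite /zexp.
  by rewrite (lcoef_represents_even _ _ FP) subrK.
have [Ee FmD1] := lowest_term F_low sFj FmD F1.
have span := components_le_span F_low sM R1 F0E.
have zx : zeta = x by rewrite xE /e Ee; lia.
split=> //.
  by exists zeta => //; rewrite hcoef zetaE.
rewrite ge_max; apply/andP; split; lia.
Qed.
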